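(* Let $k\ge 1$ be an integer. (1) For every integer $r\ge 1$ there is a constant $c_{k,r}$ such that the number of isomorphism classes of subgroup towers of length $k$ of finite abelian groups of order at most $N$ and rank at most $r$ is asymptotic to $c_{k,r}\,N(\log N)^{k-1}$ as $N\to\infty$. (2) There is a constant $c_k$ such that the number of isomorphism classes of subgroup towers of length $k$ of finite abelian groups of order at most $N$ is asymptotic to $c_k\,N(\log N)^{k-1}$ as $N\to\infty$.
   Context: A subgroup tower of length $k$ of a group $G$ is a $k$-tuple of groups $(G_1,\ldots,G_k)$ with $G_1=G$ and $G_{j+1}\subseteq G_j$ a subgroup for $1\le j<k$. Two subgroup towers $(G_1,\dots,G_k)$ and $(\tilde G_1,\dots,\tilde G_k)$ are called isomorphic if $G_i\cong\tilde G_i$ (as groups) for each $i=1,\ldots,k$. The order and rank conditions are imposed on $G=G_1$. The rank of a finite abelian group is its minimal number of generators. ''Asymptotic'' means that the ratio of the two quantities tends to $1$. *)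

(* Defs.v *)
From HB Require Import structures.
From mathcomp Require Import all_boot all_order all_algebra all_fingroup.
From mathcomp Require Import all_solvable.
From mathcomp Require Import all_classical all_reals all_analysis.

Set Implicit Arguments.
Unset Strict Implicit.
Unset Printing Implicit Defensive.

Import Order.TTheory GRing.Theory Num.Theory.
Import numFieldNormedType.Exports.

(* The terms G_1, ..., G_k are the entries 0, ..., k - 1 of the tuple. The
   ambient finite group [tower_ambient] only serves to make sense of the
   inclusions; it varies with the tower and plays no other role. *)
Record subgroup_tower (k : nat) := SubgroupTower {
  tower_ambient : finGroupType;
  tower_groups : k.-tuple {group tower_ambient};
  tower_subset :
    sorted (fun G H : {group tower_ambient} => H \subset G) tower_groups
}.

(* The group G = G_1 of which the tower is a tower. The default value 1 is
   reached only for k = 0. *)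
Definition tower_top (k : nat) (T : subgroup_tower k) :
    {group tower_ambient T} :=
  head 1%G (tower_groups T).

(* Termwise isomorphism: the isomorphisms G_i ~ G'_i are not required to be
   compatible with the inclusions. *)
Definition tower_isog (k : nat) (T T' : subgroup_tower k) : Prop :=
  forall i : 'I_k, (tnth (tower_groups T) i \isog tnth (tower_groups T') i)%g.

Definition abelian_tower_le (k N : nat) (T : subgroup_tower k) : Prop :=
  abelian (tower_top T) /\ (#|tower_top T| <= N)%N.

(* ['m(G)] is the size of a smallest generating set of G. *)
Definition abelian_tower_rank_le (k r N : nat) (T : subgroup_tower k) : Prop :=
  abelian_tower_le N T /\ ('m(tower_top T)%g <= r)%N.

(* The objects satisfying P (an E-invariant property) fall into exactly n
   classes for the equivalence relation E: there is a system of n pairwise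
   inequivalent representatives. Being relational, this does not require
   a set of classes, which for groups would raise universe issues. *)
Definition class_number (X : Type) (E : X -> X -> Prop) (P : X -> Prop)
    (n : nat) : Prop :=
  exists x : 'I_n -> X,
    [/\ forall i, P (x i),
        forall i j, E (x i) (x j) -> i = j
      & forall y, P y -> exists i, E y (x i)].

Lemma class_number_inj (X : Type) (E : X -> X -> Prop) (P : X -> Prop)
    (n m : nat) :
  (forall x y, E x y -> E y x) ->
  (forall x y z, E x y -> E y z -> E x z) ->
  class_number E P n -> class_number E P m -> n = m.
Proof.
move=> symE trE.
suff le a b : class_number E P a -> class_number E P b -> a <= b.
  by move=> Hn Hm; apply/eqP; rewrite eqn_leq !le.
move=> [x [Px injx _]] [y [_ _ cov]].
have /fin_all_exists [f Hf] : forall i, exists j, E (x i) (y j).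
  by move=> i; apply: cov.
have injf : injective f.
  move=> i j eqf; apply: injx; apply: (trE _ (y (f i))) => //.
  by apply: symE; rewrite eqf.
by rewrite -[a]card_ord -[b]card_ord; apply: leq_card injf.
Qed.

Lemma tower_isog_sym (k : nat) (T T' : subgroup_tower k) :
  tower_isog T T' -> tower_isog T' T.
Proof. by move=> E i; rewrite isog_sym. Qed.

Lemma tower_isog_trans (k : nat) (T1 T2 T3 : subgroup_tower k) :
  tower_isog T1 T2 -> tower_isog T2 T3 -> tower_isog T1 T3.
Proof. by move=> E E' i; apply: isog_trans (E i) (E' i). Qed.

Local Open Scope classical_set_scope.
Local Open Scope ring_scope.

(* Division by 0 yields 0, so this forces g N <> 0 for all large N. *)
Definition asymptotic (R : realType) (f g : nat -> R) : Prop :=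
  (fun N : nat => f N / g N) @ \oo --> (1 : R).

(* Main.v *)
(* A finite abelian group is determined by the numbers of its m-torsion elements,
   and comparing these numbers shows that a subgroup has smaller invariant
   factors. So isomorphism classes of towers with top group of order n correspond
   to families, indexed by the primes p, of chains of k partitions contained in
   each other, the largest one of size v_p(n), and they are counted by a
   multiplicative function a(n) = prod_p f(v_p(n)). Here f(0) = 1, f(1) = k, and
   f grows subexponentially, as does the number of partitions. Hence a is the
   Dirichlet convolution of the k-fold divisor function d_k with a multiplicative
   b that vanishes at primes, for which the sum of |b(n)| / n converges. As
   sum_(n <= x) d_k(n) ~ x (log x)^(k - 1) / (k - 1)!, dominated convergence
   gives the asymptotics of the summatory function of a; the constant is not zero
   because a >= d_k, as one sees by counting towers of cyclic groups. *)
Require Import Defs.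
From HB Require Import structures.
From mathcomp Require Import all_boot all_order all_algebra all_fingroup.
From mathcomp Require Import all_solvable.
From mathcomp Require Import all_classical all_reals all_analysis.
From mathcomp Require Import zify ring lra.
Import Order.TTheory GRing.Theory Num.Theory.
Import numFieldNormedType.Exports.

Set Implicit Arguments.
Unset Strict Implicit.
Unset Printing Implicit Defensive.

(** * Invariant factors of finite abelian groups *)

(** The prime 2 dictates the growth condition. The Euler factor of the sum of |b(n)| / n at 2 is a
    power series at 1/2, so f must grow more slowly than 2 ^ e; the base 3/2 used below leaves room
    for a geometric series of ratio at most 3/4. An exponential bound on the number of partitions
    would not suffice, because f is estimated by the k-th power of a partition count; growth below
    every exponential survives that power. Once b vanishes at primes, its Euler factor at p is 1 +
    O(1 / p ^ 2), and the product over primes is bounded by one over all integers, so nothing about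
    the distribution of primes enters. The convolution is carried out on finite summatory functions,
    so neither Dirichlet series nor a Tauberian theorem is needed. Both statements reduce to the
    same counting function: without a rank condition the rank bound may be taken to grow with N, but
    a partition of e has at most e parts, so f(e) stabilises. *)

Lemma minnS_ltn (e a : nat) : minn e.+1 a = (minn e a + (e < a))%N.
Proof. by case: (ltnP e a) => h /=; lia. Qed.

(* The increments in [e] of [\sum_i minn e (u i)] are the parts of the partition
   conjugate to [u]. *)
Lemma nonincreasing_le_of_minn (r : nat) (u v : 'I_r -> nat) :
  (forall i j : 'I_r, (i <= j)%N -> (u j <= u i)%N) ->
  (forall i j : 'I_r, (i <= j)%N -> (v j <= v i)%N) ->
  (forall e, \sum_i minn e.+1 (u i) + \sum_i minn e (v i)
          <= \sum_i minn e.+1 (v i) + \sum_i minn e (u i))%N ->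
  forall i, (u i <= v i)%N.
Proof.
move=> du dv huv i; rewrite leqNgt; apply/negP => lt_vu.
(* At level [v i] the hypothesis compares the numbers of [l] with [v i < u l] and with [v i < v l].
   If [v i < u i], the first is at least [i.+1] by monotonicity of [u], the second at most [i] by
   that of [v]. *)
have := huv (v i).
under eq_bigr do rewrite minnS_ltn.
under [X in (_ <= X + _)%N -> _]eq_bigr do rewrite minnS_ltn.
rewrite !big_split /= => {}huv.
have aux a b c d : (a + b + c <= c + d + a)%N -> (b <= d)%N by lia.
move/aux: huv; rewrite leqNgt => /negP; apply.
have le_ui : (i < \sum_(l < r) (v i < u l))%N.
  have -> : i.+1 = (\sum_(l < r) (l < i.+1))%N.
    rewrite -big_mkcond /= sum1_card.
    have := big_ord_widen_cond r xpredT (fun=> 1%N) (ltn_ord i).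
    by rewrite -sum1_card => <-; rewrite sum_nat_const card_ord muln1.
  apply: leq_sum => l _; rewrite ltnS; case: (leqP l i) => // le_li.
  by rewrite (leq_trans lt_vu) // du.
apply: leq_ltn_trans le_ui.
have -> : nat_of_ord i = (\sum_(l < r) (l < i))%N.
  rewrite -big_mkcond /=.
  have := big_ord_widen_cond r xpredT (fun=> 1%N) (ltnW (ltn_ord i)).
  by move=> <-; rewrite sum_nat_const card_ord muln1.
apply: leq_sum => l _; case: (ltnP l i) => [_|/dv]; first exact: leq_b1.
by rewrite leqNgt; case: (_ < _)%N.
Qed.

Lemma gcdn_pfactor (p e d : nat) : prime p -> (0 < d)%N ->
  gcdn (p ^ e) d = (p ^ minn e (logn p d))%N.
Proof.
move=> pp d_gt0.
have [m cop_m ->] := pfactor_coprime pp d_gt0.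
have m_gt0 : (0 < m)%N.
  by case: m cop_m => //; rewrite /coprime gcdn0 => /eqP p1; move: pp; rewrite p1.
rewrite Gauss_gcdr; last by rewrite coprimeXl.
rewrite lognM // ?expn_gt0 ?prime_gt0 // pfactorK // (@logn_coprime p m) // add0n.
have [le|lt] := leqP e (logn p d).
  by move/(dvdn_exp2l p): (le) => /gcdn_idPl ->.
by move/(dvdn_exp2l p): (ltnW lt) => /gcdn_idPr ->.
Qed.

Lemma card_Ldiv_cycle (gT : finGroupType) (x : gT) (m : nat) :
  #|'Ldiv_m(<[x]>)%g| = gcdn m #[x]%g.
Proof.
have -> : 'Ldiv_m(<[x]>)%g = 'Ldiv_(gcdn m #[x]%g)(<[x]>)%g.
  apply/setP => y; apply/LdivP/LdivP => -[xy /eqP ym]; split=> //; apply/eqP.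
    by rewrite -order_dvdn dvdn_gcd order_dvdn ym /= order_dvdG.
  by move: ym; rewrite -!order_dvdn dvdn_gcd => /andP[].
set g := gcdn _ _.
have g_dvd : g %| #|<[x]>%g| by apply: dvdn_gcdr.
have gLd : group_set 'Ldiv_g(<[x]>)%g by apply/group_Ldiv/cycle_abelian.
pose L := Group gLd.
have /cyclicP[y Ly] : cyclic L.
  by apply: cyclicS (cycle_cyclic x); apply: subsetIl.
(* Frobenius' theorem gives one divisibility. For the other, the torsion subgroup is cyclic, and its
   order is that of a generator, which is killed by [g]. *)
apply/eqP; rewrite eqn_dvd (Frobenius_Ldiv g_dvd) andbT.
have -> : 'Ldiv_g(<[x]>)%g = <[y]>%g by rewrite -Ly.
rewrite -/(order _) order_dvdn; apply/eqP.
by have /LdivP[] : y \in 'Ldiv_g(<[x]>)%g by rewrite -[_ :&: _]/(gval L) Ly cycle_id.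
Qed.

Lemma card_Ldiv_dprod (gT : finGroupType) (K H G : {group gT}) (m : nat) :
  abelian G -> (K \x H)%g = G ->
  #|'Ldiv_m(G)%g| = (#|'Ldiv_m(K)%g| * #|'Ldiv_m(H)%g|)%N.
Proof.
move=> cGG defG; have [_ defKH _ tiKH] := dprodP defG.
have [sKG sHG] : K \subset G /\ H \subset G.
  by rewrite -defKH mulG_subl mulG_subr.
have cKK := abelianS sKG cGG; have cHH := abelianS sHG cGG.
pose LK := Group (group_Ldiv m cKK); pose LH := Group (group_Ldiv m cHH).
have := mul_cardG LK LH.
have -> : LK :&: LH = 1%g.
  apply/trivgP/fintype.subsetP => x /setIP[/LdivP[Kx _] /LdivP[Hx _]].
  by rewrite -tiKH inE Kx.
rewrite cards1 muln1 => ->; congr #|pred_of_set _|.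
apply/setP => x; apply/LdivP/mulsgP.
  case=> Gx xm; move: Gx; rewrite -defKH => /mulsgP[a b Ka Hb xE].
  have cab : commute a b by 
    apply: (centsP cGG); [exact: (fintype.subsetP sKG)|exact: (fintype.subsetP sHG)].
  rewrite xE expgMn // in xm.
  have am : (a ^+ m)%g = ((b ^+ m)^-1)%g by apply/eqP; rewrite eq_mulgV1 invgK xm.
  have am1 : (a ^+ m)%g = 1%g.
    apply/set1gP; rewrite -tiKH inE groupX //= am groupV groupX //.
  exists a b => //; apply/LdivP; split=> //.
  by move: xm; rewrite am1 mul1g.
case=> a b /LdivP[Ka am] /LdivP[Hb bm] ->.
have [Ga Gb] := (fintype.subsetP sKG _ Ka, fintype.subsetP sHG _ Hb).
split; first by rewrite groupM.
have cab : commute a b by apply: (centsP cGG).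
by rewrite expgMn // am bm mul1g.
Qed.

Lemma card_Ldiv_abelian_type (gT : finGroupType) (G : {group gT}) (m : nat) :
  abelian G -> #|'Ldiv_m(G)%g| = \prod_(t <- abelian_type G) gcdn m t.
Proof.
move=> cGG; have [b defG <-] := abelian_structure cGG.
rewrite big_map; elim: b G cGG defG => [|x b IHb] G cGG.
  rewrite !big_nil => <-; have -> : 'Ldiv_m(1%g : {set gT})%g = [set 1%g].
    by apply/finset.setIidPl; rewrite finset.sub1set inE expg1n.
  exact: cards1.
rewrite !big_cons => defG; have [[_ H _ defH] _ _ _] := dprodP defG.
rewrite defH in defG; rewrite (card_Ldiv_dprod m cGG defG) card_Ldiv_cycle.
have [_ defxH _ _] := dprodP defG.
rewrite -(IHb H) //; apply: abelianS cGG.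
by rewrite -defxH mulG_subr.
Qed.

(** Padding with invariant factors 1 multiplies by [gcdn m 1 = 1]; it puts groups of different ranks
    over the same index set. *)
Lemma card_Ldiv_nth_abelian_type (gT : finGroupType) (G : {group gT})
    (r m : nat) : abelian G -> (size (abelian_type G) <= r)%N ->
  #|'Ldiv_m(G)%g| = \prod_(i < r) gcdn m (nth 1%N (abelian_type G) i).
Proof.
move=> cGG le_tr; rewrite card_Ldiv_abelian_type // (big_nth 1%N).
rewrite -(big_mkord xpredT (fun i => gcdn m (nth 1%N (abelian_type G) i))).
rewrite (big_cat_nat (leq0n _) le_tr) /=.
rewrite [X in (_ * X)%N]big1_seq ?muln1 // => i.
rewrite mem_index_iota => /andP[_ /andP[le_i _]].
by rewrite nth_default // gcdn1.
Qed.

Lemma nth_abelian_type_gt0 (gT : finGroupType) (G : {group gT}) (i : nat) :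
  (0 < nth 1%N (abelian_type G) i)%N.
Proof.
have [lt_i|le_i] := ltnP i (size (abelian_type G)); last by rewrite nth_default.
by have /allP/(_ _ (mem_nth 1%N lt_i))/ltnW := abelian_type_gt1 G.
Qed.

Lemma nth_abelian_type_dvdn (gT : finGroupType) (G : {group gT}) (i j : nat) :
  (i <= j)%N -> nth 1%N (abelian_type G) j %| nth 1%N (abelian_type G) i.
Proof.
move=> le_ij.
have [lt_j|le_j] := ltnP j (size (abelian_type G)); last by rewrite (nth_default _ le_j) dvd1n.
apply: (sorted_leq_nth _ _ 1%N (abelian_type_dvdn_sorted G)) => //=.
- by move=> x y z /= xy zx; apply: dvdn_trans zx xy.
- by move=> x /=.
- by rewrite inE (leq_ltn_trans le_ij).
Qed.

Lemma prod_nth_abelian_type (gT : finGroupType) (G : {group gT}) (r : nat) :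
  abelian G -> (size (abelian_type G) <= r)%N ->
  \prod_(i < r) nth 1%N (abelian_type G) i = #|G|.
Proof.
move=> cGG le_tr; transitivity #|'Ldiv_#|G|(G)%g|; last first.
  by congr #|pred_of_set _|; apply/finset.setIidPl; rewrite sub_LdivT exponent_dvdn.
rewrite (card_Ldiv_nth_abelian_type #|G| cGG le_tr).
apply: eq_bigr => i _; apply/esym/gcdn_idPr.
apply: dvdn_trans (exponent_dvdn G); apply: dvdn_trans (nth_abelian_type_dvdn _ (leq0n i)) _.
have [b defG def_t] := abelian_structure cGG.
rewrite -def_t; case: b defG {def_t} => [|x b] defG /=; first exact: dvd1n.
apply: dvdn_exponent; move: defG; rewrite big_cons => /dprodP[[_ H _ ->] <- _ _].
by rewrite -{1}[x]mulg1 mem_mulg ?cycle_id // group1.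
Qed.

Lemma dvdn_logn (m n : nat) : (0 < m)%N -> (0 < n)%N ->
  (forall p, prime p -> (logn p m <= logn p n)%N) -> m %| n.
Proof.
move=> m_gt0 n_gt0 le_mn; apply/dvdn_partP => // p _; rewrite p_part.
have [pp|npp] := boolP (prime p); last by rewrite lognE (negbTE npp) expn0 dvd1n.
by rewrite pfactor_dvdn // le_mn.
Qed.

(** The quotient of the [b]-torsion of [H] by its [a]-torsion embeds into the corresponding quotient
    for [G]. With denominators cleared this is the product formula for the [b]-torsion of [H] and
    the [a]-torsion of [G]. *)
Lemma card_Ldiv_sub (gT : finGroupType) (H G : {group gT}) (a b : nat) :
  abelian G -> H \subset G -> a %| b ->
  (#|'Ldiv_b(H)%g| * #|'Ldiv_a(G)%g| <= #|'Ldiv_b(G)%g| * #|'Ldiv_a(H)%g|)%N.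
Proof.
move=> cGG sHG dvd_ab; have cHH := abelianS sHG cGG.
pose bH := Group (group_Ldiv b cHH); pose aG := Group (group_Ldiv a cGG).
have bGg := group_Ldiv b cGG.
have := mul_cardG bH aG => /= ->.
apply: leq_mul; apply: subset_leq_card; last first.
  apply/fintype.subsetP => x /setIP[/LdivP[Hx _] /LdivP[_ xa]].
  exact/LdivP.
have : (bH * aG)%g \subset Group bGg; last by [].
rewrite mul_subG //; apply/fintype.subsetP => x /LdivP[Ax xa]; apply/LdivP.
  by rewrite (fintype.subsetP sHG).
by split=> //; apply/eqP; rewrite -order_dvdn (dvdn_trans _ dvd_ab) // order_dvdn xa.
Qed.

(** Stated for any divisor chains describing the torsion counts, not only for abelian types, so that
    the case [H = G] also yields uniqueness of such chains. *)
Lemma Ldiv_prod_dvdn (gT : finGroupType) (H G : {group gT}) (r : nat)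
    (d e : 'I_r -> nat) :
  abelian G -> H \subset G ->
  (forall i, (0 < d i)%N) -> (forall i, (0 < e i)%N) ->
  (forall i j : 'I_r, (i <= j)%N -> d j %| d i) ->
  (forall i j : 'I_r, (i <= j)%N -> e j %| e i) ->
  (forall m, #|'Ldiv_m(H)%g| = \prod_(i < r) gcdn m (d i)) ->
  (forall m, #|'Ldiv_m(G)%g| = \prod_(i < r) gcdn m (e i)) ->
  forall i, d i %| e i.
Proof.
move=> cGG sHG d_gt0 e_gt0 dd de Hd Ge i.
apply: dvdn_logn => // p pp.
move: i; apply: (nonincreasing_le_of_minn
  (u := fun i => logn p (d i)) (v := fun i => logn p (e i))).
- by move=> i j /dd; apply: dvdn_leq_log.
- by move=> i j /de; apply: dvdn_leq_log.
move=> n; have := card_Ldiv_sub cGG sHG (dvdn_exp2l p (leqnSn n)).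
rewrite !Hd !Ge.
have E k (c : 'I_r -> nat) : (forall i, (0 < c i)%N) ->
    \prod_(i < r) gcdn (p ^ k) (c i) = (p ^ \sum_(i < r) minn k (logn p (c i)))%N.
  by move=> c_gt0; rewrite expn_sum; apply: eq_bigr => i _; rewrite gcdn_pfactor.
by rewrite !E // -!expnD leq_exp2l // prime_gt1.
Qed.

Lemma card_Ldiv_isog (aT rT : finGroupType) (G : {group aT}) (H : {group rT})
  (m : nat) : (G \isog H)%g -> #|'Ldiv_m(G)%g| = #|'Ldiv_m(H)%g|.
Proof.
case/isogP => f injf <-; rewrite -(injm_Ldiv injf) card_injm //.
exact: subsetIl.
Qed.

Lemma isog_card_Ldiv (aT rT : finGroupType) (G : {group aT}) (H : {group rT}) :
  abelian G -> abelian H ->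
  (forall m, #|'Ldiv_m(G)%g| = #|'Ldiv_m(H)%g|) -> (G \isog H)%g.
Proof.
move=> cGG cHH eqGH; rewrite eq_abelian_type_isog //.
pose r := maxn (size (abelian_type G)) (size (abelian_type H)).
have LG m := card_Ldiv_nth_abelian_type m cGG (leq_maxl _ _ : _ <= r)%N.
have LH m := card_Ldiv_nth_abelian_type m cHH (leq_maxr _ _ : _ <= r)%N.
have eqt i : nth 1%N (abelian_type G) i = nth 1%N (abelian_type H) i.
  have [lt_ir|le_ri] := ltnP i r; last first.
    by move: le_ri; rewrite geq_max => /andP[h1 h2]; rewrite !nth_default.
  have LGH m := etrans (eqGH m) (LH m).
  have D (T : finGroupType) (K : {group T}) (j l : 'I_r) := @nth_abelian_type_dvdn T K j l.
  have P (T : finGroupType) (K : {group T}) (j : 'I_r) := @nth_abelian_type_gt0 T K j.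
  apply/eqP; rewrite eqn_dvd.
  rewrite (Ldiv_prod_dvdn cGG (subxx _) (P _ _) (P _ _) (D _ _) (D _ _) LG LGH (Ordinal lt_ir)).
  by rewrite (Ldiv_prod_dvdn cGG (subxx _) (P _ _) (P _ _) (D _ _) (D _ _) LGH LG (Ordinal lt_ir)).
(* Genuine entries exceed 1 and the default is 1, so equality of all padded entries forces equal
   lengths. *)
have size_le (T1 T2 : finGroupType) (K1 : {group T1}) (K2 : {group T2}) :
    (forall i, nth 1%N (abelian_type K1) i = nth 1%N (abelian_type K2) i) ->
    (size (abelian_type K1) <= size (abelian_type K2))%N.
  move=> eq12; rewrite leqNgt; apply/negP => lt21.
  have /allP/(_ _ (mem_nth 1%N lt21)) := abelian_type_gt1 K1.
  by rewrite eq12 nth_default.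
apply/eqP/(@eq_from_nth _ 1%N) => [|i _]; last exact: eqt.
by apply/eqP; rewrite eqn_leq !size_le.
Qed.

(* For [d i %| q] this is a product of cyclic groups of orders [d i]. Taking all
   the terms of a tower inside the same ['Z_q] makes inclusions trivial. *)
Definition torsion_rows (q r : nat) (d : 'I_r -> nat) : {set 'rV['Z_q]_r} :=
  [set v : 'rV['Z_q]_r | [forall i, (v ord0 i *+ d i == 0)%R]].

Lemma group_set_torsion_rows (q r : nat) (d : 'I_r -> nat) :
  group_set (torsion_rows q d).
Proof.
apply/group_setP; split.
  by rewrite inE; apply/forallP => i; rewrite mxE mul0rn.
move=> u v; rewrite !inE => /forallP hu /forallP hv; apply/forallP => i.
by rewrite mxE mulrnDl (eqP (hu i)) (eqP (hv i)) addr0.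
Qed.

Canonical torsion_rows_group (q r : nat) (d : 'I_r -> nat) :=
  Group (group_set_torsion_rows q d).

Lemma abelian_torsion_rows (q r : nat) (d : 'I_r -> nat) :
  abelian (torsion_rows q d).
Proof. by apply/centsP => u _ v _; apply: addrC. Qed.

Lemma torsion_rowsS (q r : nat) (d e : 'I_r -> nat) :
  (forall i, d i %| e i) -> torsion_rows q d \subset torsion_rows q e.
Proof.
move=> de; apply/fintype.subsetP => v; rewrite !inE => /forallP hv.
apply/forallP => i; have /dvdnP[c ->] := de i.
by rewrite mulnC mulrnA (eqP (hv i)) mul0rn.
Qed.

Lemma card_torsion_Zp (q d : nat) : (1 < q)%N -> d %| q ->
  #|[pred z : 'Z_q | (z *+ d == 0)%R]| = d.
Proof.
move=> q_gt1 dvd_dq; transitivity #|'Ldiv_d(<[(1%R : 'Z_q)]>)%g|; last first.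
  by rewrite card_Ldiv_cycle order_Zp1 Zp_cast //; apply/gcdn_idPl.
apply: eq_card => z; rewrite !inE.
have -> /= : z \in <[(1%R : 'Z_q)]>%g.
  by apply/cycleP; exists z; rewrite FinRing.zmodXgE natr_Zp.
by rewrite FinRing.zmodXgE.
Qed.

Lemma card_torsion_rows (q r : nat) (d : 'I_r -> nat) : (1 < q)%N ->
  (forall i, d i %| q) -> #|torsion_rows q d| = \prod_i d i.
Proof.
move=> q_gt1 dvd_dq.
transitivity #|family (fun i => [pred z : 'Z_q | (z *+ d i == 0)%R])|.
  pose row_of (f : {ffun 'I_r -> 'Z_q}) := (\row_i f i)%R : 'rV['Z_q]_r.
  have row_inj : injective row_of.
    by move=> f g /rowP eqfg; apply/ffunP => i; have := eqfg i; rewrite !mxE.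
  rewrite -(fintype.card_image row_inj); apply: eq_card => v; rewrite inE.
  apply/forallP/fintype.imageP => [hv|[f /familyP hf ->] i]; last by rewrite mxE; apply: hf.
  exists [ffun i => v ord0 i]; last by apply/rowP => i; rewrite mxE ffunE.
  by apply/familyP => i; rewrite ffunE inE.
transitivity (\prod_(i < r) \sum_(z : 'Z_q | (z *+ d i == 0)%R) 1)%N.
  by rewrite bigA_distr_big_dep -sum1_card; apply: eq_bigr => f _; rewrite big1_eq.
apply: eq_bigr => i _; rewrite sum1_card; exact: card_torsion_Zp.
Qed.

Lemma card_Ldiv_torsion_rows (q r : nat) (d : 'I_r -> nat) (m : nat) :
  (1 < q)%N -> (forall i, d i %| q) ->
  #|'Ldiv_m(torsion_rows q d)%g| = \prod_i gcdn m (d i).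
Proof.
move=> q_gt1 dvd_dq; rewrite -(card_torsion_rows q_gt1); last first.
  by move=> i; apply: dvdn_trans (dvd_dq i); apply: dvdn_gcdr.
have dvdE (z : 'Z_q) n : (z *+ n == 0)%R = (#[z]%g %| n) by rewrite order_dvdn FinRing.zmodXgE.
apply: eq_card => v; rewrite !inE FinRing.zmodXgE.
apply/andP/forallP => [[/forallP dv /eqP mv] i|hv].
  rewrite dvdE dvdn_gcd -!dvdE dv andbT.
  by move/rowP/(_ i): mv; rewrite mulmxnE mxE => ->.
split; first by apply/forallP => i; have := hv i; rewrite !dvdE dvdn_gcd => /andP[].
apply/eqP/rowP => i; rewrite mulmxnE [RHS]mxE; apply/eqP.
by have := hv i; rewrite !dvdE dvdn_gcd => /andP[].
Qed.

(** A prime [p] dividing the last invariant factor divides all [s] of them, so the [p]-torsion has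
    order [p ^ s]; but each of the [r] factors [gcdn p (d i)] is at most [p]. *)
Lemma size_abelian_type_le (gT : finGroupType) (G : {group gT}) (r : nat)
    (d : 'I_r -> nat) : abelian G ->
  (forall m, #|'Ldiv_m(G)%g| = \prod_i gcdn m (d i)) ->
  (size (abelian_type G) <= r)%N.
Proof.
move=> cGG Gd; set s := size _; case: (posnP s) => [->//|s_gt0].
pose p := pdiv (nth 1%N (abelian_type G) s.-1).
have pp : prime p.
  apply: pdiv_prime; have /allP := abelian_type_gt1 G; apply.
  by apply: mem_nth; rewrite prednK.
have E : (p ^ s = \prod_i gcdn p (d i))%N.
  rewrite -Gd (card_Ldiv_nth_abelian_type p cGG (leqnn _)) -[in LHS](card_ord s).
  rewrite -prod_nat_const; apply: eq_bigr => i _; apply/esym/gcdn_idPl.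
  apply: dvdn_trans (pdiv_dvd _) _; apply: nth_abelian_type_dvdn.
  by rewrite -ltnS prednK.
rewrite -(leq_exp2l _ _ (prime_gt1 pp)) E -[in leqRHS](card_ord r) -prod_nat_const.
by apply: leq_prod => i _; rewrite dvdn_leq ?prime_gt0 ?dvdn_gcdl.
Qed.

Lemma logn_prod_pfactor (N q : nat) (e : nat -> nat) : prime q ->
  (forall p, ~~ prime p -> e p = 0%N) ->
  logn q (\prod_(p < N.+1) p ^ e p) = if (q < N.+1)%N then e q else 0%N.
Proof.
move=> pq e0.
have e_gt0 p : (0 < p ^ e p)%N.
  have [pp|npp] := boolP (prime p); first by rewrite expn_gt0 prime_gt0.
  by rewrite e0.
have -> : logn q (\prod_(p < N.+1) p ^ e p) = \sum_(p < N.+1) logn q (p ^ e p).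
  apply: (big_morph_in [pred n | 0 < n]%N) => //.
  - by move=> a b; rewrite !inE muln_gt0 => -> ->.
  - by move=> a b a_gt0 b_gt0; apply: lognM.
  - exact: logn1.
  - by move=> p _; rewrite inE e_gt0.
under eq_bigr => p _ do rewrite lognX.
case: ltnP => [lt_qN|le_Nq].
  rewrite (bigD1 (Ordinal lt_qN)) //= logn_prime // eqxx muln1.
  rewrite big1 ?addn0 // => p ne_pq; have [pp|npp] := boolP (prime p).
    rewrite logn_prime //; case: eqP => [E|]; last by rewrite muln0.
    by case/eqP: ne_pq; apply: val_inj.
  by rewrite e0 ?mul0n.
apply: big1 => p _; have [pp|npp] := boolP (prime p); last by rewrite e0 ?mul0n.
rewrite logn_prime //; case: eqP => [E|]; last by rewrite muln0.
by have := ltn_ord p; rewrite -E ltnNge le_Nq.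
Qed.

Lemma prod_pfactor_logn (N n : nat) : (0 < n <= N)%N ->
  \prod_(p < N.+1) p ^ logn p n = n.
Proof.
case/andP=> n_gt0 le_nN.
have e0 p : ~~ prime p -> logn p n = 0%N by rewrite lognE => /negbTE ->.
have P_gt0 : (0 < \prod_(p < N.+1) p ^ logn p n)%N.
  apply: prodn_gt0 => p; have [pp|npp] := boolP (prime p).
    by rewrite expn_gt0 prime_gt0.
  by rewrite e0.
apply/eqP; rewrite eqn_dvd !dvdn_logn // => q pq;
  rewrite (logn_prod_pfactor _ pq e0) //; case: ltnP => // lt_Nq.
by rewrite ltn_log0 // (leq_ltn_trans le_nN).
Qed.

(** * Isomorphism classes of towers as chains of partitions *)

Section Codes.

Variables (k r : nat).

(* Row [j] of a chain array is the j-th partition of a decreasing chain of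
   [k.+1] (not [k]) partitions with at most [r] parts. *)
Definition chain_array (B : nat) := {ffun 'I_k.+1 * 'I_r -> 'I_B.+1}.

(** Monotonicity in both indices at once: along [i] each row is a partition, along [j] the rows are
    contained in each other. These are plane partitions, measured by their first row only. *)
Definition is_chain (B : nat) (E : chain_array B) :=
  [forall x : 'I_k.+1 * 'I_r, forall y : 'I_k.+1 * 'I_r,
    (x.1 <= y.1)%N && (x.2 <= y.2)%N ==> (E y <= E x)%N].

Definition chain_size (B : nat) (E : chain_array B) : nat :=
  \sum_(i < r) E (ord0, i).

(** The bound [B] makes the arrays a finite type. Entries are at most the size of the first row, so
    it excludes no chain once [e <= B]. *)
Definition chain_count (B e : nat) : nat :=
  #|[set E : chain_array B | is_chain E & chain_size E == e]|.

Lemma is_chainP (B : nat) (E : chain_array B) :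
  reflect (forall (j j' : 'I_k.+1) (i i' : 'I_r), (j <= j')%N -> (i <= i')%N ->
             (E (j', i') <= E (j, i))%N) (is_chain E).
Proof.
apply: (iffP forallP) => [h j j' i i' le_j le_i|h x].
  by have /forallP/(_ (j', i')) /= := h (j, i); rewrite le_j le_i.
apply/forallP => y; apply/implyP => /andP[]; case: x y => [j i] [j' i'] /=.
exact: h.
Qed.

Lemma chain_le_size (B : nat) (E : chain_array B) j i :
  is_chain E -> (E (j, i) <= chain_size E)%N.
Proof.
move/is_chainP => hE; apply: leq_trans (hE ord0 j i i (leq0n _) (leqnn _)) _.
by rewrite /chain_size (bigD1 i) //= leq_addr.
Qed.

(* [A p (j, i)] is the exponent of [p] in the i-th invariant factor of the j-th
   group of the tower; entries at non-prime [p] are 0. *)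
Definition tower_code (N : nat) := {ffun 'I_N.+1 -> chain_array N}.

Definition is_code (N : nat) (A : tower_code N) :=
  [forall p, is_chain (A p) && (prime p || (chain_size (A p) == 0%N))] &&
  (\prod_(p < N.+1) p ^ chain_size (A p) <= N)%N.

Definition code_div (N : nat) (A : tower_code N) (j : 'I_k.+1) (i : 'I_r) :=
  \prod_(p < N.+1) p ^ A p (j, i).

Section Code.

Variables (N : nat) (A : tower_code N).
Hypothesis hA : is_code A.

Lemma code_chain p : is_chain (A p).
Proof. by case/andP: hA => /forallP/(_ p)/andP[]. Qed.

Lemma code_nonprime (p : 'I_N.+1) x : ~~ prime p -> A p x = 0%N :> nat.
Proof.
case/andP: hA => /forallP/(_ p)/andP[ch] /orP[->//|/eqP s0] _ _.
by apply/eqP; case: x => j i; rewrite -leqn0 -s0 chain_le_size.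
Qed.

Lemma logn_code_div (p : 'I_N.+1) j i : prime p -> logn p (code_div A j i) = A p (j, i).
Proof.
move=> pp; pose e q := if (q < N.+1)%N then A (inord q) (j, i) : nat else 0%N.
have -> : code_div A j i = \prod_(q < N.+1) q ^ e q.
  by apply: eq_bigr => q _; rewrite /e ltn_ord inord_val.
rewrite logn_prod_pfactor //; first by rewrite /e ltn_ord inord_val.
by rewrite /e => q npq; case: ltnP => // lt_q; rewrite code_nonprime ?inordK.
Qed.

Lemma code_div_gt0 j i : (0 < code_div A j i)%N.
Proof.
apply: prodn_gt0 => p; have [pp|npp] := boolP (prime p).
  by rewrite expn_gt0 prime_gt0.
by rewrite code_nonprime.
Qed.

Lemma code_div_dvdn (j j' : 'I_k.+1) (i i' : 'I_r) : (j <= j')%N -> (i <= i')%N ->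
  code_div A j' i' %| code_div A j i.
Proof.
move=> le_j le_i; rewrite /code_div.
elim/big_ind2: _ => // [a b c d|p _]; first exact: dvdn_mul.
by rewrite dvdn_exp2l // (is_chainP _ (code_chain p)).
Qed.

Lemma prod_code_div : (\prod_(i < r) code_div A ord0 i <= N)%N.
Proof.
case/andP: hA => _ le_N; rewrite exchange_big /=.
by under eq_bigr do rewrite -expn_sum.
Qed.

(** A common multiple of all orders up to [N]. The shift by 2 keeps it above 1 for every [N], as
    ['Z_q] has [q] elements only for [q > 1]. *)
Definition code_modulus := (N.+2)`!.

Lemma code_modulus_gt1 : (1 < code_modulus)%N.
Proof. by rewrite /code_modulus factS (leq_trans _ (leq_pmulr _ (fact_gt0 _))). Qed.

Lemma code_div_dvd_modulus j i : code_div A j i %| code_modulus.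
Proof.
apply: dvdn_fact; rewrite code_div_gt0 /=.
have le0 : (code_div A j i <= code_div A ord0 i)%N.
  by rewrite dvdn_leq ?code_div_gt0 // code_div_dvdn.
apply: (leq_trans le0); apply: (@leq_trans N); last by rewrite !leqW.
apply: leq_trans prod_code_div; rewrite (bigD1 i) //= leq_pmulr //.
by apply: prodn_gt0 => i'; apply: code_div_gt0.
Qed.

Definition code_groups :=
  [tuple torsion_rows_group code_modulus (code_div A j) | j < k.+1].

Lemma code_groups_sorted :
  sorted (fun G H : {group 'rV['Z_code_modulus]_r} => H \subset G) code_groups.
Proof.
apply/(sortedP 1%G) => j; rewrite size_tuple => lt_j.
have lt_j' := ltnW lt_j.
rewrite -[j.+1]/(nat_of_ord (Ordinal lt_j)) nth_mktuple.
rewrite -[j]/(nat_of_ord (Ordinal lt_j')) nth_mktuple.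
by apply: torsion_rowsS => i; apply: code_div_dvdn.
Qed.

Definition code_tower := SubgroupTower code_groups_sorted.

Lemma code_tower_top : tower_top code_tower = torsion_rows_group code_modulus (code_div A ord0).
Proof.
rewrite /tower_top /= -nth0 -[0%N]/(nat_of_ord (ord0 : 'I_k.+1)).
exact: (nth_mktuple _ _ (ord0 : 'I_k.+1)).
Qed.

Lemma card_Ldiv_code_tower j m :
  #|'Ldiv_m(tnth (tower_groups code_tower) j)%g| = \prod_i gcdn m (code_div A j i).
Proof.
rewrite tnth_mktuple card_Ldiv_torsion_rows ?code_modulus_gt1 // => i.
exact: code_div_dvd_modulus.
Qed.

Lemma code_tower_rank_le : abelian_tower_rank_le r N code_tower.
Proof.
rewrite /abelian_tower_rank_le /abelian_tower_le code_tower_top.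
have cGG := abelian_torsion_rows code_modulus (code_div A ord0).
split; first split=> //.
  rewrite card_torsion_rows ?code_modulus_gt1 ?prod_code_div // => i.
  exact: code_div_dvd_modulus.
rewrite grank_abelian // -size_abelian_type //.
apply: size_abelian_type_le => // m.
have := card_Ldiv_code_tower ord0 m; rewrite tnth_mktuple; exact.
Qed.

End Code.

Lemma code_tower_inj (N : nat) (A B : tower_code N) (hA : is_code A) (hB : is_code B) :
  tower_isog (code_tower hA) (code_tower hB) -> A = B.
Proof.
move=> isoAB.
have eqd j i : code_div A j i = code_div B j i.
  have LA := card_Ldiv_code_tower hA j.
  have LB m := etrans (card_Ldiv_isog m (isoAB j)) (card_Ldiv_code_tower hB j m).
  have cGG : abelian (tnth (tower_groups (code_tower hA)) j).
    by rewrite tnth_mktuple; apply: abelian_torsion_rows.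
  have dA i1 i2 := code_div_dvdn hA (leqnn j) (i := i1) (i' := i2).
  have dB i1 i2 := code_div_dvdn hB (leqnn j) (i := i1) (i' := i2).
  apply/eqP; rewrite eqn_dvd.
  rewrite (Ldiv_prod_dvdn cGG (subxx _) (code_div_gt0 hA j) (code_div_gt0 hB j) dA dB LA LB).
  by rewrite (Ldiv_prod_dvdn cGG (subxx _) (code_div_gt0 hB j) (code_div_gt0 hA j) dB dA LB LA).
apply/ffunP => p; apply/ffunP => -[j i]; apply: val_inj => /=.
have [pp|npp] := boolP (prime p); last by rewrite !code_nonprime.
by rewrite -!logn_code_div // eqd.
Qed.

Lemma tower_groups_sub (T : subgroup_tower k.+1) (j j' : 'I_k.+1) : (j <= j')%N ->
  tnth (tower_groups T) j' \subset tnth (tower_groups T) j.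
Proof.
rewrite !(tnth_nth 1%G) => le_j.
apply: (sorted_leq_nth _ _ 1%G (tower_subset T)) => //.
- by move=> G1 G2 G3 s21 s32; apply: fintype.subset_trans s32 s21.
- by rewrite inE size_tuple.
- by rewrite inE size_tuple.
Qed.

Lemma tower_rank_le_code (N : nat) (T : subgroup_tower k.+1) :
  abelian_tower_rank_le r N T ->
  exists (A : tower_code N) (hA : is_code A), tower_isog T (code_tower hA).
Proof.
pose G j := tnth (tower_groups T) j; pose t j i := nth 1%N (abelian_type (G j)) i.
have -> : abelian_tower_rank_le r N T =
    ((abelian (G ord0) /\ (#|G ord0| <= N)%N) /\ ('m(G ord0)%g <= r)%N).
  by rewrite /abelian_tower_rank_le /abelian_tower_le /G !(tnth_nth 1%G) nth0.
case=> -[cGG leGN]; rewrite grank_abelian // => rG.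
have sG j : G j \subset G ord0 by apply: tower_groups_sub.
have cGj j : abelian (G j) := abelianS (sG j) cGG.
have tr j : (size (abelian_type (G j)) <= r)%N.
  by rewrite size_abelian_type // (leq_trans (rankS (sG j))).
have L j m := card_Ldiv_nth_abelian_type m (cGj j) (tr j).
have t_gt0 j i : (0 < t j i)%N by apply: nth_abelian_type_gt0.
have t_dvd (j j' : 'I_k.+1) (i i' : 'I_r) : (j <= j')%N -> (i <= i')%N -> t j' i' %| t j i.
  move=> le_j le_i; apply: dvdn_trans (nth_abelian_type_dvdn _ le_i) _.
  exact: (Ldiv_prod_dvdn (cGj j) (tower_groups_sub T le_j)
    (d := fun i : 'I_r => t j' i) (e := fun i : 'I_r => t j i) _ _
    (fun i1 i2 => @nth_abelian_type_dvdn _ _ i1 i2)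
    (fun i1 i2 => @nth_abelian_type_dvdn _ _ i1 i2) (L j') (L j)).
have t0N : (\prod_(i < r) t ord0 i <= N)%N by rewrite prod_nth_abelian_type.
have tN j (i : 'I_r) : (t j i <= N)%N.
  apply: (@leq_trans (t ord0 i)); first by rewrite dvdn_leq // t_dvd.
  apply: leq_trans t0N; rewrite (bigD1 i) //= leq_pmulr //.
  by apply: prodn_gt0.
(* The truncation by [inord] loses nothing, because an exponent of [t] is smaller than [t], hence
   than [N.+1]. *)
pose A : tower_code N :=
  [ffun p : 'I_N.+1 => [ffun x : 'I_k.+1 * 'I_r => inord (logn p (t x.1 x.2))]].
have AE p j i : A p (j, i) = logn p (t j i) :> nat.
  by rewrite !ffunE inordK //= ltnS (leq_trans _ (tN j i)) // ltnW // ltn_logl.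
have divA j i : code_div A j i = t j i.
  rewrite -[RHS](@prod_pfactor_logn N) ?t_gt0 ?tN //.
  by apply: eq_bigr => p _; rewrite AE.
have sizeA p : chain_size (A p) = \sum_(i < r) logn p (t ord0 i).
  by apply: eq_bigr => i _; rewrite AE.
have hA : is_code A.
  apply/andP; split; last first.
    under eq_bigr do rewrite sizeA expn_sum.
    rewrite exchange_big /= (leq_trans _ t0N) // leq_prod // => i _.
    by rewrite prod_pfactor_logn // t_gt0 tN.
  apply/forallP => p; apply/andP; split.
    apply/is_chainP => j j' i i' le_j le_i; rewrite !AE.
    by rewrite dvdn_leq_log // t_dvd.
  have [//|npp] := boolP (prime p); rewrite sizeA big1 // => i _.
  by rewrite lognE (negbTE npp).
exists A, hA => j; apply: isog_card_Ldiv => //.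
  by rewrite tnth_mktuple; apply: abelian_torsion_rows.
move=> m; rewrite card_Ldiv_code_tower L; apply: eq_bigr => i _.
by rewrite divA.
Qed.

Lemma class_number_rank_le (N : nat) :
  class_number (@tower_isog k.+1) (@abelian_tower_rank_le k.+1 r N)
    #|[set A : tower_code N | is_code A]|.
Proof.
have hx (i : 'I_#|[set A : tower_code N | is_code A]|) : is_code (enum_val i).
  by have := enum_valP i; rewrite inE.
exists (fun i => code_tower (hx i)); split=> [i|i j /code_tower_inj/enum_val_inj//|T].
  exact: code_tower_rank_le.
case/tower_rank_le_code => A [hA isoT].
have A_in : A \in [set A : tower_code N | is_code A] by rewrite inE.
exists (enum_rank_in A_in A).
move: (hx (enum_rank_in A_in A)); rewrite enum_rankK_in => [hA2|]; last by [].
by rewrite (bool_irrelevance hA2 hA).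
Qed.

End Codes.

Lemma big_ord_pos (V : Type) (idx : V) (op : Monoid.law idx) (N : nat) (F : nat -> V) :
  \big[op/idx]_(n < N.+1 | (0 < n)%N) F n = \big[op/idx]_(1 <= n < N.+1) F n.
Proof.
rewrite -(big_mkord (fun n => 0 < n)%N F) big_ltn_cond //=.
rewrite big_nat_cond [RHS]big_nat_cond; apply: eq_bigl => n; lia.
Qed.

Lemma big_ord_widen0 (V : Type) (idx : V) (op : Monoid.law idx) (m n : nat) (F : nat -> V) :
  (m <= n)%N -> (forall i, (m <= i)%N -> F i = idx) ->
  \big[op/idx]_(i < m) F i = \big[op/idx]_(i < n) F i.
Proof.
move=> le_mn F0; rewrite (big_ord_widen_cond _ xpredT F le_mn) big_mkcond /=.
by apply: eq_bigr => i _; case: ltnP => // /F0.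
Qed.

(** * Counting codes prime by prime *)

Section ChainCount.

Variables (k r : nat).

(** Codes are sorted by the order [n] of the top group. By unique factorization, having order [n] is
    a separate condition on the array at each [p], so the codes of order [n] form a product set. *)
Lemma card_codes (N : nat) :
  #|[set A : tower_code k r N | is_code A]| =
  \sum_(1 <= n < N.+1) \prod_(p < N.+1) chain_count k r N (logn p n).
Proof.
pose P (A : tower_code k r N) := \prod_(p < N.+1) p ^ chain_size (A p).
have codeP (A : tower_code k r N) (n : nat) : (0 < n <= N)%N ->
    is_code A && (P A == n) =
    [forall p : 'I_N.+1, is_chain (A p) && (chain_size (A p) == logn p n)].
  move=> n_bnd; have /andP[n_gt0 le_nN] := n_bnd.
  apply/andP/forallP => [[/andP[/forallP hA _] /eqP <-] p|hA].
    have /andP[-> pr] := hA p; rewrite /= eq_sym.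
    have [pp|npp] := boolP (prime p); last first.
      by move: pr; rewrite (negbTE npp) lognE (negbTE npp) /= => /eqP->.
    pose e q := if (q < N.+1)%N then chain_size (A (inord q)) else 0%N.
    have -> : P A = \prod_(q < N.+1) q ^ e q.
      by apply: eq_bigr => q _; rewrite /e ltn_ord inord_val.
    rewrite logn_prod_pfactor //; first by rewrite /e ltn_ord inord_val.
    rewrite /e => q npq; case: ltnP => // lt_q; apply/eqP.
    by have /andP[_] := hA (inord q); rewrite inordK // (negbTE npq).
  have PA : P A = n.
    rewrite -[RHS](prod_pfactor_logn n_bnd); apply: eq_bigr => p _.
    by have /andP[_ /eqP->] := hA p.
  rewrite PA eqxx; split=> //; apply/andP; split; last by rewrite -/(P A) PA.
  apply/forallP => p; have /andP[-> /eqP->] := hA p => /=.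
  by rewrite lognE; case: (prime p).
rewrite -sum1_card (eq_bigl (@is_code k r N)) => [|A]; last by rewrite inE.
rewrite (partition_big (fun A => inord (P A) : 'I_N.+1) (fun n : 'I_N.+1 => 0 < n)%N);
  last first.
  move=> A hA; have /andP[_ le_N] := hA; rewrite inordK // prodn_gt0 // => p.
  have [pp|npp] := boolP (prime p); first by rewrite expn_gt0 prime_gt0.
  by have /andP[/forallP/(_ p)/andP[_]] := hA; rewrite (negbTE npp) /= => /eqP->.
rewrite -big_ord_pos; apply: eq_bigr => n n_gt0.
have n_bnd : (0 < n <= N)%N by rewrite n_gt0 -ltnS ltn_ord.
have cardE (p : 'I_N.+1) : chain_count k r N (logn p n) =
    (\sum_(E : chain_array k r N | is_chain E && (chain_size E == logn p n)) 1)%N.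
  by rewrite sum1_card; apply: eq_card => E; rewrite !inE.
under [RHS]eq_bigr do rewrite cardE.
rewrite bigA_distr_big_dep; apply: eq_big => [A|A _]; last by rewrite big1_eq.
rewrite -[in RHS]topredE /= /family_mem /=; transitivity (is_code A && (P A == n)).
  have [hA|//] := boolP (is_code A); have /andP[_ le_N] := hA.
  by rewrite -val_eqE /= inordK.
by rewrite codeP.
Qed.

(** Columns are padded with zeros or cut off. Cutting is harmless when [e <= r2]: a nonzero entry in
    column [i] forces the first row to be positive in columns [0] to [i], hence [i < e]. *)
Lemma chain_count_le (r1 r2 B1 B2 e : nat) : (e <= B2)%N -> (r1 <= r2)%N || (e <= r2)%N ->
  (chain_count k r1 B1 e <= chain_count k r2 B2 e)%N.
Proof.
move=> le_eB le_er.
pose ext (E : chain_array k r1 B1) : chain_array k r2 B2 :=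
  [ffun x : 'I_k.+1 * 'I_r2 =>
    inord (if insub (x.2 : nat) is Some i then E (x.1, i) : nat else 0%N)].
have Esz (E : chain_array k r1 B1) x : is_chain E -> chain_size E = e -> (E x <= e)%N.
  by case: x => j i ch <-; apply: chain_le_size.
have E0 (E : chain_array k r1 B1) j (i : 'I_r1) : is_chain E -> chain_size E = e ->
    (r2 <= i)%N -> E (j, i) = 0%N :> nat.
  move=> ch sz le_i; have le_e2 : (e <= r2)%N.
    by case/orP: le_er => // le_r; have := ltn_ord i; rewrite ltnNge (leq_trans le_r).
  apply/eqP; rewrite -leqn0 leqNgt; apply/negP => Epos.
  have : (i.+1 <= chain_size E)%N; last by rewrite sz; lia.
  have -> : i.+1 = (\sum_(l < r1) (l < i.+1))%N.
    rewrite -big_mkcond /=.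
    have := big_ord_widen_cond r1 xpredT (fun=> 1%N) (ltn_ord i).
    by move=> <-; rewrite sum_nat_const card_ord muln1.
  apply: leq_sum => l _; rewrite ltnS; case: (leqP l i) => // le_li.
  by apply: leq_trans Epos _; apply: (is_chainP _ ch).
have extE (E : chain_array k r1 B1) j (i : 'I_r2) (i' : 'I_r1) : is_chain E -> chain_size E = e ->
    i = i' :> nat -> ext E (j, i) = E (j, i') :> nat.
  move=> ch sz eqi; rewrite ffunE /= inordK; last first.
    case: insubP => //= u _ _; rewrite ltnS (leq_trans (Esz _ _ ch sz)) //.
  case: insubP => [u _ uE|]; last by rewrite eqi ltn_ord.
  by congr (nat_of_ord (E (j, _))); apply: val_inj; rewrite /= uE.
have ext0 (E : chain_array k r1 B1) j (i : 'I_r2) : (r1 <= i)%N -> ext E (j, i) = 0%N :> nat.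
  move=> le_i; rewrite ffunE /= inordK; last by case: insubP => // u; rewrite ltnNge le_i.
  by case: insubP => // u; rewrite ltnNge le_i.
rewrite /chain_count -(card_in_imset (f := ext)); last first.
  move=> E F; rewrite !inE => /andP[chE /eqP szE] /andP[chF /eqP szF] eqEF.
  apply/ffunP => -[j i]; apply: val_inj => /=.
  have [lt_i|le_i] := ltnP i r2; last by rewrite !E0.
  by rewrite -(extE E j (Ordinal lt_i)) // -(extE F j (Ordinal lt_i)) // eqEF.
apply: subset_leq_card; apply/fintype.subsetP => F /imsetP[E].
rewrite !inE => /andP[ch /eqP sz] ->; apply/andP; split.
  apply/is_chainP => j j' i i' le_j le_i.
  have [lt_i'|le_i'] := ltnP i' r1; last by rewrite ext0.
  have lt_i : (i < r1)%N := leq_ltn_trans le_i lt_i'.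
  rewrite (extE E j i (Ordinal lt_i)) // (extE E j' i' (Ordinal lt_i')) //.
  exact: (is_chainP _ ch).
apply/eqP; rewrite -[RHS]sz /chain_size.
pose F1 i := if insub i is Some i' then E (ord0, i') : nat else 0%N.
pose F2 i := if insub i is Some i' then ext E (ord0, i') : nat else 0%N.
have -> : (\sum_(i < r2) ext E (ord0, i))%N = (\sum_(i < r2) F2 i)%N.
  by apply: eq_bigr => i _; rewrite /F2 valK.
have -> : (\sum_(i < r1) E (ord0, i))%N = (\sum_(i < r1) F1 i)%N.
  by apply: eq_bigr => i _; rewrite /F1 valK.
have F20 i : (r2 <= i)%N -> F2 i = 0%N.
  by move=> le_i; rewrite /F2 insubF // ltnNge le_i.
have F10 i : (r1 <= i)%N -> F1 i = 0%N.
  by move=> le_i; rewrite /F1 insubF // ltnNge le_i.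
rewrite (big_ord_widen0 _ (leq_maxr r1 r2) F20) (big_ord_widen0 _ (leq_maxl r1 r2) F10).
apply: eq_bigr => -[i /= _] _.
have [lt_i1|le_i1] := ltnP i r1; last first.
  rewrite F10 // /F2; case: insubP => //= u _ ui.
  by rewrite ext0 // ui.
have [lt_i2|le_i2] := ltnP i r2; last by rewrite F20 // /F1 insubT /= E0.
by rewrite /F1 /F2 !insubT /= (extE E ord0 (Ordinal lt_i2) (Ordinal lt_i1)).
Qed.

End ChainCount.

Local Open Scope ring_scope.

(** * Multiplicative functions that depend only on exponents *)

Section MultiplicativeFunctions.

Variable R : comNzRingType.
Implicit Types (u h : nat -> R).

(* Non-prime [p] contribute [u 0], so this is the intended product over primes
   only when [u 0 = 1]. *)
Definition mulf u (n : nat) : R := \prod_(p < n.+1) u (logn p n).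

Lemma mulfE u (n N : nat) : u 0%N = 1 -> (n <= N)%N ->
  mulf u n = \prod_(p < N.+1) u (logn p n).
Proof.
move=> u0 le_nN; apply: (@big_ord_widen0 _ _ *%R n.+1 N.+1 (fun p => u (logn p n))) => // p lt_np.
by rewrite ltn_log0.
Qed.

(** On multiplicative functions, partial sums of the local values amount to Dirichlet convolution
    with the constant 1. *)
Definition psum u (e : nat) : R := \sum_(i < e.+1) u i.

Lemma psum0 u : psum u 0 = u 0%N.
Proof. by rewrite /psum big_ord_recl big_ord0 addr0. Qed.

Definition logns (N d : nat) : {ffun 'I_N.+1 -> 'I_N.+1} :=
  [ffun p : 'I_N.+1 => inord (logn p d)].

Lemma lognsE (N d : nat) (p : 'I_N.+1) : (d <= N)%N -> logns N d p = logn p d :> nat.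
Proof.
move=> le_dN; rewrite ffunE inordK // ltnS.
by have [->|d_gt0] := posnP d; [rewrite logn0 | rewrite (leq_trans _ le_dN) // ltnW // ltn_logl].
Qed.

(** Expanding the product of sums gives one term for each exponent vector bounded by that of [n]; by
    unique factorization these vectors are the divisors of [n]. *)
Lemma mulf_psum u (n : nat) : u 0%N = 1 -> (0 < n)%N ->
  mulf (psum u) n = \sum_(d < n.+1 | (d %| n)%N) mulf u d.
Proof.
move=> u0 n_gt0; rewrite /mulf.
have -> : \prod_(p < n.+1) psum u (logn p n) =
    \prod_(p < n.+1) \sum_(j : 'I_n.+1 | (j <= logn p n)%N) u j.
  apply: eq_bigr => p _; rewrite /psum.
  rewrite (big_ord_widen_cond n.+1 xpredT u) //=.
  by rewrite ltnS ltnW // ltn_logl.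
rewrite bigA_distr_big_dep.
pose inv (e : {ffun 'I_n.+1 -> 'I_n.+1}) : 'I_n.+1 := inord (\prod_(p < n.+1) p ^ e p).
have invE (e : {ffun 'I_n.+1 -> 'I_n.+1}) : (forall p, (e p <= logn p n)%N) ->
    inv e = (\prod_(p < n.+1) p ^ e p)%N :> nat /\ logns n (inv e) = e.
  move=> le_e.
  pose f q := if (q < n.+1)%N then e (inord q) : nat else 0%N.
  have f0 q : ~~ prime q -> f q = 0%N.
    rewrite /f => npq; case: ltnP => // lt_q; apply/eqP; rewrite -leqn0.
    by rewrite (leq_trans (le_e _)) // inordK // lognE (negbTE npq).
  have fE : (\prod_(p < n.+1) p ^ e p = \prod_(p < n.+1) p ^ f p)%N.
    by apply: eq_bigr => p _; rewrite /f ltn_ord inord_val.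
  have lt_n : (\prod_(p < n.+1) p ^ e p < n.+1)%N.
    rewrite ltnS dvdn_leq // -[X in (_ %| X)%N](@prod_pfactor_logn n n) ?n_gt0 ?leqnn //.
    elim/big_ind2: _ => // [a b c d|p _]; first exact: dvdn_mul.
    exact: dvdn_exp2l.
  have vinv : inv e = (\prod_(p < n.+1) p ^ e p)%N :> nat by rewrite inordK.
  split=> //; apply/ffunP => p; apply: val_inj => /=.
  rewrite lognsE; last by rewrite -ltnS ltn_ord.
  have [pp|npp] := boolP (prime p).
    by rewrite vinv fE logn_prod_pfactor // ltn_ord /f ltn_ord inord_val.
  rewrite lognE (negbTE npp) /=; have := f0 _ npp.
  by rewrite /f ltn_ord inord_val.
rewrite (reindex_onto (fun d : 'I_n.+1 => logns n d) inv) /=; last first.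
  move=> e /familyP he; have [//|_ -> //] := invE e.
have lgE (d p : 'I_n.+1) : logns n d p = logn p d :> nat.
  by rewrite lognsE // -ltnS ltn_ord.
apply: eq_big => [d|d _]; last first.
  rewrite -/(mulf u d) (@mulfE u d n) //; last by rewrite -ltnS.
  by apply: eq_bigr => p _; rewrite lgE.
apply/andP/idP => [[/familyP hd /eqP dE]|dvd_dn].
  have [|vinv _] := invE (logns n d); first by move=> p; apply: hd.
  rewrite -dE vinv -[X in (_ %| X)%N](@prod_pfactor_logn n n) ?n_gt0 ?leqnn //.
  elim/big_ind2: _ => // [a b c e|p _]; first exact: dvdn_mul.
  exact/dvdn_exp2l/hd.
have d_gt0 : (0 < d)%N by rewrite (dvdn_gt0 n_gt0).
have le_log p : (logns n d p <= logn p n)%N by rewrite lgE dvdn_leq_log.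
split; first by apply/familyP => p; apply: le_log.
have [vinv _] := invE _ le_log; apply/eqP/val_inj; rewrite /= vinv.
rewrite -[RHS](@prod_pfactor_logn n d) /=; last by rewrite d_gt0 /= -ltnS.
by apply: eq_bigr => p _; rewrite lgE.
Qed.

Definition summ h (N : nat) : R := \sum_(1 <= n < N.+1) h n.

Definition hyperbola (H : nat -> R) (N : nat) : R := \sum_(1 <= m < N.+1) H (N %/ m)%N.

(** Both sides sum [mulf u d] over the pairs [(d, m)] with [d * m <= N], grouped by the product on
    the left and by [m] on the right. *)
Lemma summ_psum u (N : nat) : u 0%N = 1 ->
  summ (mulf (psum u)) N = hyperbola (summ (mulf u)) N.
Proof.
move=> u0; transitivity (\sum_(1 <= d < N.+1) mulf u d *+ (N %/ d)).
  rewrite /summ; under eq_big_nat => n /andP[n_gt0 le_nN].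
    rewrite mulf_psum // (big_ord_widen_cond N.+1 (fun d => d %| n)%N (mulf u)) //.
    over.
  transitivity (\sum_(1 <= n < N.+1) \sum_(1 <= d < N.+1 ) mulf u d *+ (d %| n)%N).
    apply: eq_big_nat => n /andP[n_gt0 le_nN].
    rewrite -[RHS]big_ord_pos big_mkcond [RHS]big_mkcond /=.
    apply: eq_bigr => d _; rewrite mulrb ltnS.
    case: (boolP (d %| n)%N) => [dvd_dn|_]; last by case: (0 < d)%N.
    by rewrite dvdn_leq // (dvdn_gt0 n_gt0).
  rewrite exchange_big /=; apply: eq_big_nat => d _.
  by rewrite divn_count_dvd (big_morph _ (mulrnDr (mulf u d)) (mulr0n (mulf u d))).
rewrite /hyperbola /summ.
transitivity (\sum_(1 <= m < N.+1) \sum_(1 <= d < N.+1) mulf u d *+ (m <= N %/ d)%N).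
  rewrite exchange_big /=; apply: eq_big_nat => d /andP[d_gt0 _].
  rewrite -(big_morph _ (mulrnDr (mulf u d)) (mulr0n (mulf u d))); congr (_ *+ _).
  have le_dN : (N %/ d <= N)%N by apply: leq_div.
  rewrite (big_cat_nat (n := (N %/ d).+1)) //= addnC big_nat big1 ?add0n => [|i /andP[lt_i _]].
    rewrite big_nat (eq_bigr (fun=> 1%N)) => [|i /andP[_ lt_i]]; last by rewrite -ltnS lt_i.
    by rewrite -big_nat sum_nat_const_nat muln1 subn1.
  by rewrite leqNgt lt_i.
apply: eq_big_nat => m /andP[m_gt0 le_mN].
have le_N : (N %/ m <= N)%N by apply: leq_div.
rewrite (big_cat_nat (n := (N %/ m).+1)) //= addrC big_nat big1 ?add0r => [|d /andP[lt_d ltdN]].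
  apply: eq_big_nat => d /andP[d_gt0 le_d].
  by rewrite leq_divRL // mulnC -leq_divRL // -ltnS le_d.
rewrite leq_divRL; last by apply: leq_ltn_trans lt_d.
by rewrite mulnC -leq_divRL // leqNgt lt_d.
Qed.

Lemma hyperbola0 (H : nat -> R) : hyperbola H 0 = 0.
Proof. by rewrite /hyperbola big_geq. Qed.

Lemma eq_hyperbola (H1 H2 : nat -> R) : H1 =1 H2 -> hyperbola H1 =1 hyperbola H2.
Proof. by move=> eqH N; apply: eq_bigr. Qed.

Lemma summ_iter_psum u (k N : nat) : u 0%N = 1 ->
  summ (mulf (iter k psum u)) N = iter k hyperbola (summ (mulf u)) N.
Proof.
move=> u0; elim: k N => [//|k IHk] N /=; rewrite summ_psum.
  by apply: eq_hyperbola => n.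
by elim: k {IHk} => //= k <-; rewrite psum0.
Qed.

(* The number of k-tuples of positive integers with product at most [N]. *)
Definition divisor_summ (k N : nat) : R := iter k hyperbola (fun n => (0 < n)%N%:R) N.

Lemma divisor_summ0 (k : nat) : divisor_summ k 0 = 0.
Proof. by case: k => [//|k]; rewrite /divisor_summ /= hyperbola0. Qed.

Lemma divisor_summS (k N : nat) : divisor_summ k.+1 N =
  \sum_(1 <= m < N.+1) divisor_summ k (N %/ m).
Proof. by []. Qed.

(** Associativity of convolution: the factors 1 are collected into a divisor function. Sums may be
    extended to the common range because [divisor_summ k 0 = 0]. *)
Lemma iter_hyperbola_summ (k N : nat) h :
  iter k hyperbola (summ h) N = \sum_(1 <= m < N.+1) h m * divisor_summ k (N %/ m).
Proof.
elim: k N => [|k IHk] N.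
  apply: eq_big_nat => m /andP[m_gt0 lt_m].
  by rewrite /divisor_summ /= divn_gt0 // -ltnS lt_m mulr1.
rewrite iterS (eq_hyperbola IHk).
transitivity (\sum_(1 <= l < N.+1) \sum_(1 <= m < N.+1) h m * divisor_summ k (N %/ l %/ m)).
  apply: eq_big_nat => l /andP[l_gt0 lt_l].
  have le_N : (N %/ l <= N)%N by apply: leq_div.
  rewrite [RHS](big_cat_nat (n := (N %/ l).+1)) //= [X in _ = _ + X]big_nat.
  rewrite [X in _ = _ + X]big1 ?addr0 // => m /andP[lt_m _].
  by rewrite (divn_small lt_m) divisor_summ0 mulr0.
rewrite exchange_big /=; apply: eq_big_nat => m /andP[m_gt0 lt_m].
rewrite -mulr_sumr; congr (_ * _); rewrite /hyperbola.
have le_N : (N %/ m <= N)%N by apply: leq_div.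
rewrite (big_cat_nat (n := (N %/ m).+1)) //= [X in _ + X]big_nat.
rewrite [X in _ + X]big1 ?addr0 // => [|l /andP[lt_l _]].
  by apply: eq_bigr => l _; rewrite -!divnMA mulnC.
by rewrite -divnMA mulnC divnMA (divn_small lt_l) divisor_summ0.
Qed.

End MultiplicativeFunctions.

(** * Summatory functions of divisor functions *)

Section DivisorSummBounds.

Variable R : realType.
Local Notation D := (divisor_summ R).

(** Convexity: a power lies above its tangent at [b]. Since [a] and [b] are not ordered, this bounds
    increments of powers from both sides. *)
Lemma ler_subX (a b : R) (n : nat) : 0 <= a -> 0 <= b ->
  n.+1%:R * b ^+ n * (a - b) <= a ^+ n.+1 - b ^+ n.+1.
Proof.
move=> a0 b0; elim: n => [|n IHn]; first by rewrite expr0 !expr1; lra.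
have -> : a ^+ n.+2 - b ^+ n.+2 = a * (a ^+ n.+1 - b ^+ n.+1) + b ^+ n.+1 * (a - b).
  by rewrite !exprS; ring.
apply: (@le_trans _ _ (a * (n.+1%:R * b ^+ n * (a - b)) + b ^+ n.+1 * (a - b))).
  have -> : a * (n.+1%:R * b ^+ n * (a - b)) + b ^+ n.+1 * (a - b) =
     n.+2%:R * b ^+ n.+1 * (a - b) + n.+1%:R * (b ^+ n * (a - b) ^+ 2).
    by rewrite -[n.+2%:R]natr1 !exprS expr0; ring.
  by rewrite lerDl mulr_ge0 // mulr_ge0 ?sqr_ge0 // exprn_ge0.
by rewrite lerD2r ler_wpM2l.
Qed.

Lemma ln_succ_sub_le (n : nat) : (0 < n)%N -> ln n.+1%:R - ln n%:R <= n%:R^-1 :> R.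
Proof.
move=> n0; have n0' : 0 < n%:R :> R by rewrite ltr0n.
rewrite -ln_div ?posrE ?ltr0n //.
have -> : n.+1%:R / n%:R = 1 + n%:R^-1 :> R by rewrite -natr1; field; lra.
by apply: le_ln1Dx; rewrite (@lt_trans _ _ 0) ?invr_gt0 //; lra.
Qed.

Lemma ln_succ_sub_ge (n : nat) : (0 < n)%N -> n.+1%:R^-1 <= ln n.+1%:R - ln n%:R :> R.
Proof.
move=> n0; have n0' : 0 < n%:R :> R by rewrite ltr0n.
have n1' : 0 < n.+1%:R :> R by rewrite ltr0n.
rewrite -[leRHS]opprK lerNr opprB -ln_div ?posrE ?ltr0n //.
have -> : n%:R / n.+1%:R = 1 + - n.+1%:R^-1 :> R by rewrite -natr1; field; rewrite natr1; lra.
by apply: le_ln1Dx; rewrite ltrN2 invf_lt1 // ltr1n.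
Qed.

Lemma divisor_summ_ge0 (k N : nat) : 0 <= D k N.
Proof.
elim: k N => [|k IHk] N; first by rewrite /divisor_summ /= ler0n.
by rewrite divisor_summS; apply: sumr_ge0 => m _; apply: IHk.
Qed.

Lemma divisor_summ1 (N : nat) : D 1 N = N%:R.
Proof.
rewrite divisor_summS big_nat (eq_bigr (fun=> 1)) => [|m /andP[m_gt0 le_mN]].
  by rewrite -big_nat sumr_const_nat subn1.
by rewrite /divisor_summ /= divn_gt0 // -ltnS le_mN.
Qed.

Lemma divn_ler (N m : nat) : (N %/ m)%N%:R <= N%:R / m%:R :> R.
Proof.
have [->|m_gt0] := posnP m; first by rewrite divn0 invr0 mulr0.
by rewrite ler_pdivlMr ?ltr0n // -natrM ler_nat leq_divM.
Qed.

Lemma divn_succ_ger (N m : nat) : (0 < m)%N -> N.+1%:R / m%:R <= (N %/ m).+1%:R :> R.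
Proof.
move=> m_gt0; rewrite ler_pdivrMr ?ltr0n // -natrM ler_nat.
by rewrite [X in (X < _)%N](divn_eq N m) mulSn addnC ltn_add2r ltn_mod.
Qed.

(** Comparison with the integral of [(ln N - ln t + k) ^ k / t]: by convexity the terms from [m = 2]
    on telescope, and raising the shift from [k] to [k.+1] pays for the term [m = 1]. *)
Lemma sum_pow_ln_le (k N M : nat) : (0 < M <= N)%N ->
  k.+1%:R * \sum_(1 <= m < M.+1) (m%:R^-1 * (ln N%:R - ln m%:R + k%:R) ^+ k)
  <= (ln N%:R + k.+1%:R) ^+ k.+1 - (ln N%:R - ln M%:R + k%:R) ^+ k.+1 :> R.
Proof.
case: M => // M /andP[_]; elim: M => [|M IHM] le_MN.
  rewrite big_nat1 invr1 mul1r ln1 subr0 -[k.+1%:R in leRHS]natr1 addrA.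
  have lnN : 0 <= ln N%:R :> R by rewrite ln_ge0 // ler1n.
  have y0 : 0 <= ln N%:R + k%:R :> R by rewrite addr_ge0.
  have := @ler_subX (ln N%:R + k%:R + 1) (ln N%:R + k%:R) k (addr_ge0 y0 ler01) y0.
  by rewrite [X in _ * X <= _]addrAC subrr add0r mulr1.
rewrite big_nat_recr //= mulrDr.
have {IHM}IH := IHM (ltnW le_MN).
set y1 := ln N%:R - ln M.+1%:R + k%:R in IH *; set y2 := ln N%:R - ln M.+2%:R + k%:R.
have yE : y1 - y2 = ln M.+2%:R - ln M.+1%:R by rewrite /y1 /y2; ring.
have y_ge n : (0 < n <= N)%N -> 0 <= ln N%:R - ln n%:R + k%:R :> R.
  move=> /andP[n0 le_n]; rewrite addr_ge0 // subr_ge0 ler_ln ?posrE ?ltr0n ?ler_nat //.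
  exact: leq_trans le_n.
have y1_ge0 : 0 <= y1 by apply: y_ge; apply: ltnW.
have y2_ge0 : 0 <= y2 by apply: y_ge.
have h := ler_subX k y1_ge0 y2_ge0.
have h2 : k.+1%:R * (M.+2%:R^-1 * y2 ^+ k) <= k.+1%:R * y2 ^+ k * (y1 - y2).
  rewrite yE mulrCA [leRHS]mulrC; apply: ler_wpM2r; last exact: ln_succ_sub_ge.
  by rewrite mulr_ge0 // exprn_ge0.
by apply: le_trans (lerD IH (le_trans h2 h)) _; rewrite addrA subrK.
Qed.

(** The shift of the logarithm absorbs all lower order terms, so the bound has the exact leading
    constant and holds for every positive [N]. This uniformity later provides the dominating
    terms. *)
Lemma divisor_summ_le (k N : nat) : (0 < N)%N ->
  D k.+1 N <= N%:R * (ln N%:R + k%:R) ^+ k / k`!%:R.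
Proof.
elim: k N => [|k IHk] N N_gt0; first by rewrite divisor_summ1 expr0 mulr1 fact0 divr1.
have N0 : 0 < N%:R :> R by rewrite ltr0n.
rewrite divisor_summS.
apply: (@le_trans _ _ (\sum_(1 <= m < N.+1)
  (N%:R / k`!%:R * (m%:R^-1 * (ln N%:R - ln m%:R + k%:R) ^+ k)))).
  rewrite !big_nat; apply: ler_sum => m /andP[m_gt0 le_mN].
  have m0 : 0 < m%:R :> R by rewrite ltr0n.
  have q_gt0 : (0 < N %/ m)%N by rewrite divn_gt0 // -ltnS.
  apply: le_trans (IHk _ q_gt0) _.
  have -> : N%:R / k`!%:R * (m%:R^-1 * (ln N%:R - ln m%:R + k%:R) ^+ k) =
    N%:R / m%:R * (ln N%:R - ln m%:R + k%:R) ^+ k / k`!%:R :> R by ring.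
  have q0 : 0 <= ln (N %/ m)%N%:R + k%:R :> R by rewrite addr_ge0 // ln_ge0 // ler1n.
  have y0 : 0 <= ln N%:R - ln m%:R + k%:R :> R.
    by rewrite addr_ge0 // subr_ge0 ler_ln ?posrE ?ltr0n // ler_nat -ltnS.
  rewrite ler_wpM2r ?invr_ge0 // ler_pM ?exprn_ge0 ?divn_ler // lerXn2r ?nnegrE //.
  by rewrite lerD2r -ln_div ?posrE // ler_ln ?posrE ?ltr0n ?divr_gt0 ?divn_ler.
rewrite -mulr_sumr factS natrM invfM.
have -> : N%:R * (ln N%:R + k.+1%:R) ^+ k.+1 * (k.+1%:R^-1 / k`!%:R) =
  N%:R / k`!%:R * ((ln N%:R + k.+1%:R) ^+ k.+1 / k.+1%:R) :> R by ring.
rewrite ler_wpM2l ?divr_ge0 // ler_pdivlMr ?ltr0n // mulrC.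
have := @sum_pow_ln_le k N N; rewrite N_gt0 leqnn => /(_ isT)/le_trans; apply.
by rewrite subrr add0r gerDl oppr_le0 exprn_ge0.
Qed.

Lemma sum_pow_ln_ge (k N M : nat) : (M <= N)%N ->
  ln N.+1%:R ^+ k.+1 - (ln N.+1%:R - ln M.+1%:R) ^+ k.+1 <=
  k.+1%:R * \sum_(1 <= m < M.+1) (m%:R^-1 * (ln N.+1%:R - ln m%:R) ^+ k) :> R.
Proof.
elim: M => [|M IHM] le_MN; first by rewrite big_geq // ln1 subr0 mulr0 subrr.
have {IHM}IH := IHM (ltnW le_MN).
rewrite big_nat_recr //= mulrDr.
set z1 := ln N.+1%:R - ln M.+1%:R in IH *; set z2 := ln N.+1%:R - ln M.+2%:R.
have zE : z1 - z2 = ln M.+2%:R - ln M.+1%:R by rewrite /z1 /z2; ring.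
have z_ge n : (n <= N)%N -> 0 <= ln N.+1%:R - ln n.+1%:R :> R.
  by move=> le_n; rewrite subr_ge0 ler_ln ?posrE ?ltr0n ?ler_nat.
have z1_ge0 : 0 <= z1 by apply: z_ge; rewrite ltnW.
have z2_ge0 : 0 <= z2 by apply: z_ge.
have h := ler_subX k z2_ge0 z1_ge0.
have h2 : k.+1%:R * z1 ^+ k * (z1 - z2) <= k.+1%:R * (M.+1%:R^-1 * z1 ^+ k).
  rewrite zE [leRHS]mulrCA [leLHS]mulrC; apply: ler_wpM2r; last exact: ln_succ_sub_le.
  by rewrite mulr_ge0 // exprn_ge0.
apply: le_trans (lerD IH h2); move: h; rewrite -[z2 - z1]opprB mulrN lerNl opprB.
by move/(lerD (lexx (ln N.+1%:R ^+ k.+1 - z1 ^+ k.+1))); rewrite addrA subrK.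
Qed.

(** The error term is of lower order and reproduces itself: summing [D k (N %/ m)] over [m] gives
    [D k.+1 N]. The main term uses [N.+1] because [N.+1 / m] is at most [(N %/ m).+1]. *)
Lemma divisor_summ_ge (k N : nat) : (0 < N)%N ->
  N.+1%:R * ln N.+1%:R ^+ k / k`!%:R - D k N <= D k.+1 N.
Proof.
elim: k N => [|k IHk] N N_gt0.
  by rewrite divisor_summ1 expr0 mulr1 fact0 divr1 /divisor_summ /= N_gt0 -[N.+1%:R]natr1 addrK.
have N0 : 0 < N.+1%:R :> R by rewrite ltr0n.
rewrite [D k.+2 N]divisor_summS.
apply: (@le_trans _ _ (\sum_(1 <= m < N.+1)
   (N.+1%:R / k`!%:R * (m%:R^-1 * (ln N.+1%:R - ln m%:R) ^+ k) - D k (N %/ m)))).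
  rewrite sumrB -divisor_summS lerD2r -mulr_sumr factS natrM invfM.
  have -> : N.+1%:R * ln N.+1%:R ^+ k.+1 * (k.+1%:R^-1 / k`!%:R) =
    N.+1%:R / k`!%:R * (ln N.+1%:R ^+ k.+1 / k.+1%:R) :> R by ring.
  rewrite ler_wpM2l ?divr_ge0 // ler_pdivrMr ?ltr0n // mulrC.
  by have := sum_pow_ln_ge k (leqnn N); rewrite subrr expr0n subr0 mulrC.
rewrite !big_nat; apply: ler_sum => m /andP[m_gt0 le_mN].
have m0 : 0 < m%:R :> R by rewrite ltr0n.
have q_gt0 : (0 < N %/ m)%N by rewrite divn_gt0 // -ltnS.
apply: le_trans (IHk _ q_gt0); rewrite lerD2r.
have -> : N.+1%:R / k`!%:R * (m%:R^-1 * (ln N.+1%:R - ln m%:R) ^+ k) =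
    N.+1%:R / m%:R * (ln N.+1%:R - ln m%:R) ^+ k / k`!%:R :> R by ring.
have z0 : 0 <= ln N.+1%:R - ln m%:R :> R.
  by rewrite subr_ge0 ler_ln ?posrE ?ltr0n // ler_nat ltnW.
rewrite ler_wpM2r ?invr_ge0 // ler_pM ?exprn_ge0 ?divr_ge0 ?divn_succ_ger //.
rewrite lerXn2r ?nnegrE ?ln_ge0 ?ler1n //.
by rewrite -ln_div ?posrE // ler_ln ?posrE ?ltr0n ?divr_gt0 ?divn_succ_ger.
Qed.

End DivisorSummBounds.

(** * Limits of normalized divisor sums, and dominated convergence *)

Section DivisorSummLimit.

Local Open Scope classical_set_scope.

Variable R : realType.
Local Notation D := (divisor_summ R).

Lemma cvgM_seq (f g : nat -> R) (a b : R) :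
  f n @[n --> \oo] --> a -> g n @[n --> \oo] --> b -> f n * g n @[n --> \oo] --> a * b.
Proof. exact: cvgM. Qed.

Lemma squeeze_seq (f g h : nat -> R) (l : R) :
  f n @[n --> \oo] --> l -> h n @[n --> \oo] --> l ->
  (\forall n \near \oo, f n <= g n <= h n) -> g n @[n --> \oo] --> l.
Proof. by move=> fl hl fgh; exact: (squeeze_cvgr fgh fl hl). Qed.

Lemma cvg_natV : (n%:R : R)^-1 @[n --> \oo] --> (0 : R).
Proof.
apply/gtr0_cvgV0; last exact: cvgr_idn.
by near=> n; rewrite ltr0n; near: n; exact: nbhs_infty_gt.
Unshelve. all: by end_near. Qed.

Lemma cvg_lnV : (ln (n%:R : R))^-1 @[n --> \oo] --> (0 : R).
Proof.
apply/gtr0_cvgV0.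
  by near=> n; rewrite ln_gt0 // ltr1n; near: n; exact: nbhs_infty_gt.
apply/cvgryPge => A; near=> n.
rewrite -[A]expRK ler_ln ?posrE ?expR_gt0 //; last first.
  by rewrite ltr0n; near: n; exact: nbhs_infty_gt.
by near: n; exact: nbhs_infty_ger.
Unshelve. all: by end_near. Qed.

Lemma cvg_exprn (f : nat -> R) (a : R) (k : nat) :
  f n @[n --> \oo] --> a -> f n ^+ k @[n --> \oo] --> a ^+ k.
Proof.
move=> fa; elim: k => [|k IHk].
  by rewrite expr0; under eq_fun do rewrite expr0; exact: cvg_cst.
by rewrite exprS; under eq_fun do rewrite exprS; exact: cvgM fa IHk.
Qed.

Definition scale (k N : nat) : R := N%:R * ln N%:R ^+ k.

Lemma scale_gt0 (k N : nat) : (1 < N)%N -> 0 < scale k N.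
Proof.
by move=> N1; rewrite mulr_gt0 ?ltr0n ?(ltnW N1) // exprn_gt0 // ln_gt0 // ltr1n.
Qed.

Lemma divisor_summ_scale_le (k N : nat) : (1 < N)%N ->
  D k.+1 N / scale k N <= (1 + k%:R * (ln N%:R)^-1) ^+ k / k`!%:R.
Proof.
move=> N1; have L0 : 0 < ln N%:R :> R by rewrite ln_gt0 // ltr1n.
rewrite ler_pdivrMr ?scale_gt0 //.
apply: le_trans (divisor_summ_le _ _ (ltnW N1)) _.
have -> : ln N%:R + k%:R = ln N%:R * (1 + k%:R * (ln N%:R)^-1) :> R by field; lra.
by rewrite /scale exprMn le_eqVlt; apply/orP; left; apply/eqP; ring.
Qed.

Lemma cvg_scale_bound (k : nat) :
  (1 + k%:R * (ln (n%:R : R))^-1) ^+ k / k`!%:R @[n --> \oo] --> (k`!%:R^-1 : R).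
Proof.
suff h : (1 + k%:R * (ln (n%:R : R))^-1) ^+ k @[n --> \oo] --> (1 : R).
  have {}h := cvgMr_tmp (b := k`!%:R^-1) h; rewrite mul1r in h; exact: h.
rewrite -[X in _ --> X](expr1n _ k); apply: cvg_exprn.
rewrite -[X in _ --> X]addr0 -(mulr0 (k%:R : R)).
by apply: cvgD; [exact: cvg_cst|apply: cvgMl_tmp; exact: cvg_lnV].
Qed.

Lemma cvg_divisor_summ_small (k : nat) : D k n / scale k n @[n --> \oo] --> (0 : R).
Proof.
case: k => [|k].
  apply: cvg_trans cvg_natV; apply: near_eq_cvg; near=> n.
  rewrite /scale expr0 mulr1 /divisor_summ /=.
  have -> : (0 < n)%N by near: n; exact: nbhs_infty_gt.
  by rewrite div1r.
have h := cvgM_seq (@cvg_scale_bound k) cvg_lnV; rewrite mulr0 in h;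
have c0 : (fun _ : nat => 0 : R) n @[n --> \oo] --> (0 : R) by exact: cvg_cst.
apply: (squeeze_seq c0 h); near=> n.
have n1 : (1 < n)%N by near: n; exact: nbhs_infty_gt.
have L0 : 0 < ln n%:R :> R by rewrite ln_gt0 // ltr1n.
rewrite divr_ge0 ?divisor_summ_ge0 ?(ltW (scale_gt0 _ _)) //=.
have -> : D k.+1 n / scale k.+1 n = D k.+1 n / scale k n / ln n%:R.
  by rewrite /scale exprSr mulrA invfM mulrA.
by rewrite ler_wpM2r ?invr_ge0 ?(ltW L0) // divisor_summ_scale_le.
Unshelve. all: by end_near. Qed.

Lemma cvg_divisor_summ (k : nat) :
  D k.+1 n / scale k n @[n --> \oo] --> (k`!%:R^-1 : R).
Proof.
have h : k`!%:R^-1 - D k n / scale k n @[n --> \oo] --> (k`!%:R^-1 : R).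
  by rewrite -[X in _ --> X]subr0; apply: cvgB; [exact: cvg_cst|exact: cvg_divisor_summ_small].
apply: (squeeze_seq h (@cvg_scale_bound k)); near=> n.
have n1 : (1 < n)%N by near: n; exact: nbhs_infty_gt.
have n0 : 0 < n%:R :> R by rewrite ltr0n ltnW.
rewrite divisor_summ_scale_le // andbT ler_pdivlMr ?scale_gt0 //.
apply: le_trans (divisor_summ_ge R k (ltnW n1)).
rewrite mulrBl divfK ?gt_eqF ?scale_gt0 // lerD2r mulrC ler_wpM2r ?invr_ge0 //.
rewrite /scale ler_pM ?exprn_ge0 ?ler_nat ?ln_ge0 ?ler1n ?(ltnW n1) //.
by rewrite lerXn2r ?nnegrE ?ln_ge0 ?ler1n ?(ltnW n1) // ler_ln ?posrE ?ltr0n ?ler_nat // ltnW.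
Unshelve. all: by end_near. Qed.

Lemma cvg_divn (m : nat) : (0 < m)%N -> (n %/ m)%N @[n --> \oo] --> \oo.
Proof.
move=> m_gt0; apply/cvgnyPge => A; near=> n.
by rewrite leq_divRL //; near: n; exact: nbhs_infty_ge.
Unshelve. all: by end_near. Qed.

Lemma cvg_divn_ratio (m : nat) : (0 < m)%N ->
  (n %/ m)%N%:R / n%:R @[n --> \oo] --> (m%:R^-1 : R).
Proof.
move=> m_gt0; have m0 : 0 < m%:R :> R by rewrite ltr0n.
have h : m%:R^-1 - n%:R^-1 @[n --> \oo] --> (m%:R^-1 : R).
  by rewrite -[X in _ --> X]subr0; apply: cvgB; [exact: cvg_cst|exact: cvg_natV].
have c1 : (fun _ : nat => m%:R^-1 : R) n @[n --> \oo] --> (m%:R^-1 : R) by exact: cvg_cst.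
apply: (squeeze_seq h c1); near=> n.
have n_gt0 : (0 < n)%N by near: n; exact: nbhs_infty_gt.
have n0 : 0 < n%:R :> R by rewrite ltr0n.
rewrite ler_pdivlMr // ler_pdivrMr // [X in _ && (_ <= X)]mulrC divn_ler andbT.
rewrite mulrBl mulVf ?gt_eqF // lerBlDr natr1 mulrC.
by apply: le_trans (divn_succ_ger R n m_gt0); rewrite ler_wpM2r ?invr_ge0 ?(ltW m0) ?ler_nat.
Unshelve. all: by end_near. Qed.

Lemma cvg_ln_divn_ratio (m : nat) : (0 < m)%N ->
  ln (n %/ m)%N%:R / ln n%:R @[n --> \oo] --> (1 : R).
Proof.
move=> m_gt0; have m0 : 0 < m%:R :> R by rewrite ltr0n.
(* With [q = n %/ m] positive, [n < m * (q + 1) <= 2 * m * q]. *)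
have h : 1 - ln (2 * m%:R) * (ln (n%:R : R))^-1 @[n --> \oo] --> (1 : R).
  rewrite -[X in _ --> X]subr0 -(mulr0 (ln (2 * m%:R) : R)).
  by apply: cvgB; [exact: cvg_cst|apply: cvgMl_tmp; exact: cvg_lnV].
have c1 : (fun _ : nat => 1 : R) n @[n --> \oo] --> (1 : R) by exact: cvg_cst.
apply: (squeeze_seq h c1); near=> n.
have n1 : (1 < n)%N by near: n; exact: nbhs_infty_gt.
have n0 : 0 < n%:R :> R by rewrite ltr0n ltnW.
have L0 : 0 < ln n%:R :> R by rewrite ln_gt0 // ltr1n.
have q_gt0 : (0 < n %/ m)%N by rewrite divn_gt0 //; near: n; exact: nbhs_infty_ge.
have q0 : 0 < (n %/ m)%N%:R :> R by rewrite ltr0n.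
rewrite ler_pdivlMr // ler_pdivrMr // mul1r mulrBl mul1r divfK ?gt_eqF //.
apply/andP; split; last by rewrite ler_ln ?posrE // ler_nat leq_div.
rewrite lerBlDr -lnM ?posrE ?mulr_gt0 // ler_ln ?posrE ?mulr_gt0 //.
rewrite -!natrM ler_nat mulnCA mulnA.
rewrite (leq_trans (ltnW (ltn_ceil n m_gt0))) // leq_mul2r; apply/orP; right; lia.
Unshelve. all: by end_near. Qed.

(** The logarithm varies slowly, so replacing [n] by [n %/ m] costs only the factor [1 / m]. *)
Lemma cvg_divisor_summ_divn (k m : nat) : (0 < m)%N ->
  D k.+1 (n %/ m) / scale k n @[n --> \oo] --> (m%:R^-1 / k`!%:R : R).
Proof.
move=> m_gt0.
have h1 : D k.+1 (n %/ m) / scale k (n %/ m) @[n --> \oo] --> (k`!%:R^-1 : R).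
  exact: (cvg_comp (fun n => (n %/ m)%N) (fun n => D k.+1 n / scale k n)
            (cvg_divn m_gt0) (@cvg_divisor_summ k)).
have h2 := cvg_exprn (k := k) (cvg_ln_divn_ratio m_gt0); rewrite expr1n in h2.
have h := cvgM_seq (cvgM_seq (cvg_divn_ratio m_gt0) h1) h2; rewrite mulr1 in h;
apply: cvg_trans h; apply: near_eq_cvg; near=> n.
have n1 : (1 < n)%N by near: n; exact: nbhs_infty_gt.
have q1 : (1 < n %/ m)%N by rewrite leq_divRL //; near: n; exact: nbhs_infty_ge.
have L1 : ln n%:R != 0 :> R by rewrite gt_eqF // ln_gt0 // ltr1n.
have L2 : ln (n %/ m)%N%:R != 0 :> R by rewrite gt_eqF // ln_gt0 // ltr1n.
have n0 : n%:R != 0 :> R by rewrite pnatr_eq0 -lt0n ltnW.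
have q0 : (n %/ m)%N%:R != 0 :> R by rewrite pnatr_eq0 -lt0n ltnW.
rewrite /= /scale expr_div_n; field.
by rewrite n0 q0 !expf_neq0.
Unshelve. all: by end_near. Qed.

Lemma cvg_sum_nat (t : nat -> nat -> R) (tau : nat -> R) (M : nat) :
  (forall m, t N m @[N --> \oo] --> tau m) ->
  \sum_(0 <= m < M) t N m @[N --> \oo] --> \sum_(0 <= m < M) tau m.
Proof.
move=> ttau; elim: M => [|M IHM].
  by rewrite big_geq //; under eq_fun do rewrite big_geq //; exact: cvg_cst.
by rewrite big_nat_recr //; under eq_fun do rewrite big_nat_recr //; exact: cvgD.
Qed.

(* Tannery's theorem *)
Lemma cvg_sum_dominated (t : nat -> nat -> R) (tau w : nat -> R) (K : R) :
  (forall N, \sum_(0 <= m < N) w m <= K) ->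
  (\forall N \near \oo, forall m, `|t N m| <= w m) ->
  (forall m, t N m @[N --> \oo] --> tau m) ->
  exists l : R, \sum_(0 <= m < N.+1) t N m @[N --> \oo] --> l.
Proof.
move=> wK tw ttau.
have w_ge0 m : 0 <= w m.
  by have [N _ /(_ N (leqnn N) m)] := tw; exact: le_trans.
have ndw : {homo series w : n m / (n <= m)%N >-> n <= m}.
  by apply: nondecreasing_series => n _ _.
have cw : cvgn (series w).
  by apply: nondecreasing_is_cvgn => //; exists K => _ [N _ <-]; exact: wK.
have tau_le m : `|tau m| <= w m.
  have h : `|t N m| @[N --> \oo] --> `|tau m| by apply: cvg_norm.
  rewrite -(cvg_lim _ h) //; apply: limr_le; first by apply/cvg_ex; exists `|tau m|.
  by near=> N; move: m {h}; near: N.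
have ctau : cvgn (series tau).
  by apply: normed_cvg; exact: (series_le_cvg _ w_ge0 tau_le cw).
exists (limn (series tau)); apply/cvgrPdist_le => e e0.
have e3 : 0 < e / 3 by rewrite divr_gt0.
have /cvgrPdist_le/(_ _ e3) hw := cw.
have /cvgrPdist_le/(_ _ e3) htau := ctau.
near \oo => M.
have hwM : `|limn (series w) - series w M| <= e / 3 by near: M.
have htauM : `|limn (series tau) - series tau M| <= e / 3 by near: M.
have /cvgrPdist_le/(_ _ e3) ht := cvg_sum_nat (M := M) ttau.
near=> N.
have htN : `|\sum_(0 <= m < M) tau m - \sum_(0 <= m < M) t N m| <= e / 3 by near: N.
have le_MN : (M <= N.+1)%N by apply: leqW; near: N; exact: nbhs_infty_ge.
have htwN : forall m, `|t N m| <= w m by near: N.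
rewrite (big_cat_nat (leq0n M) le_MN) /=.
have tail : `|\sum_(M <= m < N.+1) t N m| <= e / 3.
  apply: le_trans (ler_norm_sum _ _ _) _.
  apply: (@le_trans _ _ (\sum_(M <= m < N.+1) w m)); first by apply: ler_sum.
  have -> : \sum_(M <= m < N.+1) w m = series w N.+1 - series w M.
    by rewrite /series /= (big_cat_nat (leq0n M) le_MN) /= addrAC subrr add0r.
  apply: le_trans (le_trans (ler_norm _) hwM); rewrite lerD2r.
  exact: nondecreasing_cvgn_le.
have -> : limn (series tau) - (\sum_(0 <= m < M) t N m + \sum_(M <= m < N.+1) t N m) =
  (limn (series tau) - series tau M) +
  (\sum_(0 <= m < M) tau m - \sum_(0 <= m < M) t N m) - \sum_(M <= m < N.+1) t N m.
  by rewrite /series /=; ring.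
apply: le_trans (ler_normB _ _) _.
have := ler_normD (limn (series tau) - series tau M)
  (\sum_(0 <= m < M) tau m - \sum_(0 <= m < M) t N m).
lra.
Unshelve. all: by end_near. Qed.

End DivisorSummLimit.

(** * Summatory functions of multiplicative functions *)

Section MultiplicativeAsymptotics.

Local Open Scope classical_set_scope.

Variable R : realType.
Local Notation D := (divisor_summ R).

Lemma cvg_summ_convolution (k : nat) (b : nat -> R) (K : R) :
  (forall N, \sum_(1 <= m < N.+1) `|b m| / m%:R <= K) ->
  exists l : R, iter k.+1 (@hyperbola R) (summ b) N / scale R k N @[N --> \oo] --> l.
Proof.
move=> bK; pose t N m := b m * (D k.+1 (N %/ m) / scale R k N).
(* As soon as [ln N >= 1], [ln (N %/ m) + k] is at most [(1 + k) * ln N]. *)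
pose C : R := (1 + k%:R) ^+ k / k`!%:R.
have C_ge0 : 0 <= C by rewrite divr_ge0 // exprn_ge0 // addr_ge0.
have [l hl] : exists l : R, \sum_(0 <= m < N.+1) t N m @[N --> \oo] --> l.
  apply: (@cvg_sum_dominated R t (fun m => b m * (m%:R^-1 / k`!%:R))
    (fun m => `|b m| / m%:R * C) (K * C)).
  - case=> [|N].
      rewrite big_geq // mulr_ge0 //; apply: le_trans (bK 0%N).
      by rewrite big_geq.
    rewrite big_ltn // invr0 mulr0 mul0r add0r -mulr_suml.
    exact: ler_wpM2r.
  - near=> N => m; rewrite /t normrM -mulrA ler_wpM2l //.
    have N1 : (1 < N)%N by near: N; exact: nbhs_infty_gt.
    have lnN : 1 <= ln N%:R :> R.
      rewrite -[leLHS]expRK ler_ln ?posrE ?expR_gt0 ?ltr0n ?(ltnW N1) //.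
      by near: N; exact: nbhs_infty_ger.
    rewrite ger0_norm ?divr_ge0 ?divisor_summ_ge0 ?(ltW (scale_gt0 _ _ _)) //.
    have [->|m_gt0] := posnP m; first by rewrite divn0 divisor_summ0 mul0r invr0 mul0r.
    have m0 : 0 < m%:R :> R by rewrite ltr0n.
    rewrite ler_pdivrMr ?scale_gt0 //.
    have [q0|q_gt0] := posnP (N %/ m).
      rewrite q0 divisor_summ0; apply: mulr_ge0; last exact/ltW/scale_gt0.
      by apply: mulr_ge0 => //; rewrite invr_ge0 ltW.
    apply: le_trans (divisor_summ_le _ _ q_gt0) _.
    have -> : m%:R^-1 * C * scale R k N = N%:R / m%:R * (ln N%:R * (1 + k%:R)) ^+ k / k`!%:R.
      by rewrite /C /scale exprMn; ring.
    have lnq : 0 <= ln (N %/ m)%N%:R :> R by rewrite ln_ge0 // ler1n.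
    rewrite ler_wpM2r ?invr_ge0 // ler_pM ?exprn_ge0 ?divn_ler ?addr_ge0 //.
    rewrite lerXn2r ?nnegrE ?mulr_ge0 ?addr_ge0 // ?(le_trans _ lnN) //.
    rewrite mulrDr mulr1 lerD //; last by rewrite ler_peMl.
    by rewrite ler_ln ?posrE ?ltr0n ?(ltnW N1) // ler_nat leq_div.
  - move=> m; apply: cvgMl_tmp.
    have [->|m_gt0] := posnP m; last exact: cvg_divisor_summ_divn.
    under eq_fun do rewrite divn0 divisor_summ0 mul0r.
    by rewrite invr0 mul0r; exact: cvg_cst.
exists l; apply: cvg_trans hl; apply: near_eq_cvg; near=> N.
(* The extra term at [m = 0] vanishes, since [N %/ 0 = 0] and [D k.+1 0 = 0]. *)
rewrite iter_hyperbola_summ big_ltn // /t divn0 divisor_summ0 mul0r mulr0 add0r.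
by rewrite mulr_suml; apply: eq_bigr => m _; rewrite mulrA.
Unshelve. all: by end_near. Qed.

Lemma sum_geometric_le (x : R) (n : nat) : 0 <= x -> x <= 3 / 4 ->
  \sum_(i < n) x ^+ i <= 4.
Proof.
move=> x0 x1; have := subrX1 x n; have := exprn_ge0 n x0.
have S0 : 0 <= \sum_(i < n) x ^+ i by apply: sumr_ge0 => i _; exact: exprn_ge0.
nra.
Qed.

(** A telescoping substitute for the sum of [1 / p ^ 2]; the term at [p = 0] is 0. *)
Lemma sum_inv_mul_succ_le (n : nat) : \sum_(p < n) (p%:R * p.+1%:R)^-1 <= 1 :> R.
Proof.
case: n => [|n]; first by rewrite big_ord0.
suff -> : \sum_(p < n.+1) (p%:R * p.+1%:R)^-1 = 1 - n.+1%:R^-1 :> R.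
  by rewrite gerBl invr_ge0.
elim: n => [|n IHn]; first by rewrite big_ord_recl big_ord0 mul0r invr0 invr1 addr0 subrr.
rewrite big_ord_recr /= IHn.
have h1 : n.+1%:R != 0 :> R by rewrite pnatr_eq0.
have h2 : n.+2%:R != 0 :> R by rewrite pnatr_eq0.
have E : n.+2%:R = n.+1%:R + 1 :> R by rewrite natr1.
by move: h1 h2; rewrite E; move: (n.+1%:R : R) => a h1 h2; field; rewrite h1 h2.
Qed.

(* The terms of the p-th Euler factor of the series of [`|mulf g n| / n]. *)
Definition euler_weight (g : nat -> R) (p j : nat) : R :=
  if prime p then `|g j| / p%:R ^+ j else (j == 0%N)%:R.

(** As [g 1 = 0], the tail starts at [j = 2]. With [x = 3 / (2 * p) <= 3 / 4] it is at most
    [4 * C * x ^ 2 = 9 * C / p ^ 2], and [p + 1 <= 2 * p] turns this into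
    [18 * C / (p * (p + 1))]. *)
Lemma sum_euler_weight_le (g : nat -> R) (C : R) (p n : nat) :
  g 0%N = 1 -> g 1%N = 0 -> (forall e, `|g e| <= C * (3 / 2) ^+ e) ->
  \sum_(j < n) euler_weight g p j <= expR (18 * C * (p%:R * p.+1%:R)^-1).
Proof.
move=> g0 g1 gC.
have C1 : 1 <= C by have := gC 0%N; rewrite g0 normr1 expr0 mulr1.
have c0 : 0 <= (p%:R * p.+1%:R)^-1 :> R by rewrite invr_ge0 mulr_ge0.
apply: le_trans (expR_ge1Dx _); rewrite /euler_weight.
have [pp|npp] := boolP (prime p); last first.
  apply: (@le_trans _ _ 1); last by rewrite lerDl mulr_ge0 // mulr_ge0 //; lra.
  case: n => [|n]; first by rewrite big_ord0.
  by rewrite big_ord_recl big1 ?addr0.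
have p2 : 2 <= p%:R :> R by rewrite ler_nat prime_gt1.
have p0 : 0 < p%:R :> R by lra.
case: n => [|[|n]]; first by rewrite big_ord0 addr_ge0 // mulr_ge0 // mulr_ge0; lra.
  by rewrite big_ord_recl big_ord0 g0 normr1 expr0 divr1 addr0 lerDl mulr_ge0 // mulr_ge0; lra.
rewrite !big_ord_recl /= g0 g1 normr1 normr0 mul0r expr0 divr1 add0r lerD2l.
pose x : R := 3 / 2 / p%:R.
have x0 : 0 <= x by rewrite !divr_ge0.
have x1 : x <= 3 / 4 by rewrite ler_pdivrMr //; lra.
apply: (@le_trans _ _ (\sum_(i < n) C * x ^+ 2 * x ^+ i)).
  apply: ler_sum => i _; rewrite /= !/bump /= !add1n.
  rewrite ler_pdivrMr ?exprn_gt0 //; apply: le_trans (gC _) _.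
  rewrite -mulrA -exprD addnC addn2 -mulrA -exprMn /x divfK //.
  by rewrite gt_eqF.
rewrite -mulr_sumr.
apply: (@le_trans _ _ (C * x ^+ 2 * 4)).
  by rewrite ler_wpM2l ?sum_geometric_le // mulr_ge0 ?sqr_ge0 //; lra.
rewrite -[p.+1%:R]natr1 ler_pdivlMr; last by rewrite mulr_gt0 //; lra.
have -> : C * x ^+ 2 * 4 * (p%:R * (p%:R + 1)) = 9 * C * ((p%:R + 1) / p%:R).
  by rewrite /x; field; rewrite gt_eqF.
have h : (p%:R + 1) / p%:R <= 2 :> R by rewrite ler_pdivrMr //; lra.
apply: (@le_trans _ _ (9 * C * 2)); first by rewrite ler_wpM2l //; lra.
lra.
Qed.

(** Each [n <= N] accounts for its own term in the expansion of the Euler product truncated to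
    [p <= N] and exponents up to [N]; as all terms are nonnegative, that product bounds the sum. *)
Lemma sum_norm_mulf_le (g : nat -> R) (C : R) :
  g 0%N = 1 -> g 1%N = 0 -> (forall e, `|g e| <= C * (3 / 2) ^+ e) ->
  forall N, \sum_(1 <= n < N.+1) `|mulf g n| / n%:R <= expR (18 * C).
Proof.
move=> g0 g1 gC N.
have C1 : 1 <= C by have := gC 0%N; rewrite g0 normr1 expr0 mulr1.
have w_ge0 p j : 0 <= euler_weight g p j.
  by rewrite /euler_weight; case: ifP => _ //; rewrite divr_ge0 ?exprn_ge0.
rewrite -big_ord_pos.
pose F (e : {ffun 'I_N.+1 -> 'I_N.+1}) := \prod_(p < N.+1) euler_weight g p (e p).
have F_ge0 e : 0 <= F e by apply: prodr_ge0.
apply: (@le_trans _ _ (\sum_(n < N.+1 | (0 < n)%N) F (logns N n))).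
  apply: ler_sum => n n_gt0; have le_nN : (n <= N)%N by rewrite -ltnS.
  rewrite (mulfE g0 le_nN) normr_prod.
  rewrite -{2}(@prod_pfactor_logn N n) ?n_gt0 // natr_prod -prodfV -big_split /=.
  rewrite le_eqVlt; apply/orP; left; apply/eqP; apply: eq_bigr => p _.
  rewrite lognsE // /euler_weight natrX; case: ifP => // /negbT npp.
  by rewrite lognE (negbTE npp) /= g0 normr1 expr0 divr1.
have inj_logns : {in [pred n : 'I_N.+1 | (0 < n)%N] &, injective (fun n : 'I_N.+1 => logns N n)}.
  move=> m n m_gt0 n_gt0 /= eq_mn; apply: val_inj => /=.
  have le_N (i : 'I_N.+1) : (i <= N)%N by rewrite -ltnS.
  rewrite -[LHS](@prod_pfactor_logn N m) ?le_N ?andbT //.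
  rewrite -[RHS](@prod_pfactor_logn N n) ?le_N ?andbT //.
  by apply: eq_bigr => p _; rewrite -!lognsE // eq_mn.
rewrite -(big_imset F inj_logns) /=.
apply: (@le_trans _ _ (\sum_e F e)).
  by rewrite [leRHS](bigID (mem (finset.imset (fun n : 'I_N.+1 => logns N n)
    (mem [pred n : 'I_N.+1 | (0 < n)%N])))) /= lerDl sumr_ge0.
rewrite -(bigA_distr_bigA (fun p j : 'I_N.+1 => euler_weight g p j)) /=.
apply: (@le_trans _ _ (\prod_(p < N.+1) expR (18 * C * (p%:R * p.+1%:R)^-1))).
  apply: ler_prod => p _; rewrite sumr_ge0 //= sum_euler_weight_le //.
rewrite -expR_sum ler_expR -mulr_sumr ler_piMr ?sum_inv_mul_succ_le //; lra.
Qed.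

(** Inverse of [psum]: on multiplicative functions, convolution with the Möbius function. *)
Definition pdiff (u : nat -> R) (e : nat) : R := u e - (if e is e'.+1 then u e' else 0).

Lemma pdiffS (u : nat -> R) (e : nat) : pdiff u e.+1 = u e.+1 - u e.
Proof. by []. Qed.

Lemma psumK (u : nat -> R) : psum (pdiff u) = u.
Proof.
apply/funext => e; rewrite /psum; elim: e => [|e IHe].
  by rewrite big_ord_recl big_ord0 /pdiff subr0 addr0.
by rewrite big_ord_recr /= IHe /pdiff addrC subrK.
Qed.

Lemma iter_psumK (n : nat) (u : nat -> R) : iter n (@psum R) (iter n pdiff u) = u.
Proof. by elim: n u => [//|n IHn] u; rewrite iterSr /= psumK IHn. Qed.

Lemma iter_pdiff0 (n : nat) (u : nat -> R) : iter n pdiff u 0 = u 0%N.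
Proof. by elim: n => [//|n <-]; rewrite /= /pdiff subr0. Qed.

Lemma iter_pdiff1 (n : nat) (u : nat -> R) : iter n pdiff u 1 = u 1%N - n%:R * u 0%N.
Proof.
elim: n => [|n IHn]; first by rewrite mul0r subr0.
by rewrite iterS pdiffS IHn iter_pdiff0 -natr1; ring.
Qed.

Lemma iter_pdiff_le (n : nat) (u : nat -> R) (C : R) :
  (forall e, `|u e| <= C * (3 / 2) ^+ e) ->
  forall e, `|iter n pdiff u e| <= 2 ^+ n * C * (3 / 2) ^+ e.
Proof.
move=> uC; elim: n => [|n IHn] e; first by rewrite expr0 mul1r.
have C0 : 0 <= C by have := uC 0%N; rewrite expr0 mulr1; exact: le_trans.
rewrite iterS; case: e => [|e].
  by rewrite [pdiff _ 0]subr0 (le_trans (IHn 0%N)) // !expr0 !mulr1 ler_wpM2r //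
    exprS ler_peMl ?exprn_ge0 ?ler1n.
rewrite pdiffS; apply: le_trans (ler_normB _ _) _.
have h1 := IHn e.+1; have h2 := IHn e.
apply: le_trans (lerD h1 h2) _.
have q0 : 0 <= 2 ^+ n * C * (3 / 2) ^+ e by rewrite !mulr_ge0 ?exprn_ge0 ?divr_ge0.
by rewrite !exprS; lra.
Qed.

(* The lower bound on [f] serves only to make the limit positive: it says that
   [mulf f] dominates the (k + 1)-fold divisor function. *)
Lemma cvg_summ_mulf (k : nat) (f : nat -> R) (C : R) :
  f 0%N = 1 -> f 1%N = k.+1%:R -> (forall e, `|f e| <= C * (3 / 2) ^+ e) ->
  (forall e, iter k.+1 (@psum R) (fun e => (e == 0%N)%:R) e <= f e) ->
  exists2 c : R, 0 < c & summ (mulf f) N / scale R k N @[N --> \oo] --> c.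
Proof.
move=> f0 f1 fC fge; pose g := iter k.+1 pdiff f.
have g0 : g 0%N = 1 by rewrite /g iter_pdiff0.
have g1 : g 1%N = 0 by rewrite /g iter_pdiff1 f0 f1 mulr1 subrr.
have fE N : summ (mulf f) N = iter k.+1 (@hyperbola R) (summ (mulf g)) N.
  by rewrite -summ_iter_psum // /g iter_psumK.
have [c hc] := cvg_summ_convolution k
  (sum_norm_mulf_le g0 g1 (iter_pdiff_le k.+1 fC)).
exists c; last by under eq_fun do rewrite fE.
apply: (@lt_le_trans _ _ k`!%:R^-1); first by rewrite invr_gt0 ltr0n fact_gt0.
(* [mulf delta] is the unit of Dirichlet convolution, so iterated partial sums of [delta] give the
   divisor function; [fge] compares it with [mulf f] prime by prime. *)
pose delta e : R := (e == 0%N)%:R.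
have mulf_delta n : (0 < n)%N -> mulf delta n = (n == 1%N)%:R.
  move=> n_gt0; case: eqP => [->|/eqP n1].
    by rewrite /mulf big1 // => p _; rewrite logn1.
  have n_gt1 : (1 < n)%N by rewrite ltn_neqAle eq_sym n1.
  have lt_p : (pdiv n < n.+1)%N by rewrite ltnS pdiv_leq.
  rewrite /mulf (bigD1 (Ordinal lt_p)) //= /delta.
  by rewrite -(pnatr_eq0 R) gt_eqF ?mul0r // ltr0n logn_gt0
    mem_primes pdiv_prime //= n_gt0 pdiv_dvd.
have DE N : D k.+1 N = summ (mulf (iter k.+1 (@psum R) delta)) N.
  rewrite summ_iter_psum // /divisor_summ; congr (iter _ _ _ _).
  apply/funext => -[|n]; first by rewrite /summ big_geq.
  rewrite /summ big_ltn // mulf_delta // big_nat big1 ?addr0 // => i /andP[i_gt1 _].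
  by rewrite mulf_delta ?(ltnW i_gt1) // gtn_eqF.
have psum_ge0 n e : 0 <= iter n (@psum R) delta e.
  by elim: n e => [|n IHn] e; rewrite ?ler0n //= /psum sumr_ge0.
have hD := @cvg_divisor_summ R k.
have le1 : \forall N \near \oo, D k.+1 N / scale R k N <=
    iter k.+1 (@hyperbola R) (summ (mulf g)) N / scale R k N.
  near=> N; rewrite -fE DE ler_wpM2r //.
    by rewrite invr_ge0 ltW // scale_gt0 //; near: N; exact: nbhs_infty_gt.
  apply: ler_sum => n _; apply: ler_prod => p _.
  by rewrite psum_ge0 fge.
exact: ler_cvg_to hD hc le1.
Unshelve. all: by end_near. Qed.

End MultiplicativeAsymptotics.

(** * The number of chains of partitions *)

Section ChainCountBounds.

Variable k : nat.

Lemma chain_count0 (r B : nat) : chain_count k r B 0 = 1%N.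
Proof.
rewrite -(cards1 ([ffun=> ord0] : chain_array k r B)); apply: eq_card => E.
rewrite !inE; apply/andP/eqP => [[ch /eqP sz]|->].
  apply/ffunP => -[j i]; rewrite ffunE; apply: val_inj => /=; apply/eqP.
  by rewrite -leqn0 -sz chain_le_size.
split; first by apply/is_chainP => j j' i i' _ _; rewrite !ffunE.
by rewrite /chain_size big1 // => i _; rewrite ffunE.
Qed.

(** A chain of size 1 lives in column 0, where it is a decreasing sequence of zeros and ones
    starting with 1. Its sum, between 1 and [k.+1], determines it. *)
Lemma chain_count1_le (r B : nat) : (chain_count k r.+1 B 1 <= k.+1)%N.
Proof.
pose s (E : chain_array k r.+1 B) := (\sum_j E (j, ord0))%N.
have E01 (E : chain_array k r.+1 B) x : is_chain E -> chain_size E = 1%N -> (E x <= 1)%N.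
  by case: x => j i ch <-; exact: chain_le_size.
have E0 (E : chain_array k r.+1 B) j (i : 'I_r.+1) : is_chain E -> chain_size E = 1%N ->
    (0 < i)%N -> E (j, i) = 0%N :> nat.
  move=> ch sz i_gt0; have /is_chainP h := ch.
  have h1 : (E (ord0, ord0) + E (ord0, i) <= 1)%N.
    rewrite -sz /chain_size (bigD1 ord0) //= leq_add2l (bigD1 i) /= ?leq_addr //.
    by rewrite -val_eqE /= -lt0n.
  have h2 := h ord0 ord0 ord0 i (leqnn _) (leq0n _).
  have h3 := h ord0 j i i (leq0n _) (leqnn _).
  have aux a b c : (a + b <= 1 -> b <= a -> c <= b -> c = 0)%N by lia.
  exact: aux h1 h2 h3.
have s_bnd (E : chain_array k r.+1 B) : is_chain E -> chain_size E = 1%N -> (0 < s E <= k.+1)%N.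
  move=> ch sz; apply/andP; split.
    rewrite /s (bigD1 ord0) //= ltn_addr //.
    have : chain_size E = E (ord0, ord0).
      rewrite /chain_size (bigD1 ord0) //= big1 ?addn0 // => i i_neq0.
      by rewrite E0 // lt0n; apply: contra i_neq0 => /eqP i0; apply/eqP/val_inj.
    by rewrite sz => <-.
  rewrite -[leqRHS]card_ord -sum1_card; apply: leq_sum => j _; exact: E01.
have s_inj (E F : chain_array k r.+1 B) : is_chain E -> chain_size E = 1%N ->
    is_chain F -> chain_size F = 1%N -> s E = s F -> forall j, (E (j, ord0) <= F (j, ord0))%N.
  move=> chE szE chF szF eqs; apply: nonincreasing_le_of_minn.
  - by move=> i j le_ij; have /is_chainP := chE; apply.
  - by move=> i j le_ij; have /is_chainP := chF; apply.
  move=> e; have sumE (G : chain_array k r.+1 B) n : is_chain G -> chain_size G = 1%N ->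
      (\sum_j minn n.+1 (G (j, ord0)))%N = s G.
    by move=> ch sz; apply: eq_bigr => j _; apply/minn_idPr; rewrite (leq_trans (E01 _ _ ch sz)).
  rewrite !sumE // eqs; case: e => [|e]; last by rewrite !sumE // eqs.
  by rewrite !big1 // => j _; rewrite min0n.
rewrite -[X in (_ <= X)%N]card_ord.
pose h (E : chain_array k r.+1 B) : 'I_k.+1 := inord (s E).-1.
rewrite /chain_count -(card_in_imset (f := h)); first exact: max_card.
move=> E F; rewrite !inE => /andP[chE /eqP szE] /andP[chF /eqP szF].
have bE := s_bnd E chE szE; have bF := s_bnd F chF szF.
move/(congr1 val) => /=; rewrite !inordK; [|lia|lia] => eqs.
have {}eqs : s E = s F by lia.
apply/ffunP => -[j i]; apply: val_inj => /=.
have [i0|i_gt0] := posnP i; last by rewrite !E0.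
have -> : i = ord0 by apply: val_inj.
by apply/eqP; rewrite eqn_leq !s_inj.
Qed.

(** The value of the [n.+1]-fold divisor function at [p ^ e]; the induction is the hockey stick
    identity. *)
Lemma iter_psum_delta (R : comNzRingType) (n e : nat) :
  iter n.+1 (@psum R) (fun e => (e == 0%N)%:R) e = 'C(n + e, n)%:R.
Proof.
elim: n e => [|n IHn] e.
  by rewrite /= /psum big_ord_recl big1 ?addr0 ?bin0.
rewrite iterS /psum; under eq_bigr do rewrite IHn.
rewrite -natr_sum; congr (_%:R); elim: e => [|e IHe].
  by rewrite big_ord_recl big_ord0 !addn0 !binn.
by rewrite big_ord_recr /= IHe !addSn !addnS binS.
Qed.

(** Chains with a single nonzero column suffice. Such a column, starting at [e], is encoded by its
    successive differences, [k.+1] natural numbers with sum [e]; the suffix sums [S] recover it. *)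
Lemma chain_count_ge (r B e : nat) : (e <= B)%N -> ('C(k + e, k) <= chain_count k r.+1 B e)%N.
Proof.
move=> le_eB; rewrite -card_ord_partitions.
pose S (t : k.+1.-tuple 'I_e.+1) (j : nat) := (\sum_(l < k.+1 | (j <= l)%N) tnth t l)%N.
have S0 (t : k.+1.-tuple 'I_e.+1) : S t 0%N = (\sum_(i <- t) i)%N by rewrite big_tuple.
have S_le (t : k.+1.-tuple 'I_e.+1) i j : (i <= j)%N -> (S t j <= S t i)%N.
  move=> le_ij; rewrite /S big_mkcond [leqRHS]big_mkcond; apply: leq_sum => l _.
  by case: (leqP j l) => // le_jl; rewrite (leq_trans le_ij le_jl).
have S_rec (t : k.+1.-tuple 'I_e.+1) (j : 'I_k.+1) : S t j = (tnth t j + S t j.+1)%N.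
  rewrite /S (bigD1 j) //=; congr addn; apply: eq_bigl => l.
  by rewrite ltn_neqAle eq_sym andbC.
pose h (t : k.+1.-tuple 'I_e.+1) : chain_array k r.+1 B :=
  [ffun x : 'I_k.+1 * 'I_r.+1 => inord (if x.2 == ord0 then S t x.1 else 0%N)].
have hE (t : k.+1.-tuple 'I_e.+1) j i : (\sum_(i <- t) i)%N = e ->
    h t (j, i) = (if i == ord0 then S t j else 0%N) :> nat.
  move=> sum_t; rewrite ffunE inordK //=; case: ifP => // _.
  by rewrite ltnS (leq_trans _ le_eB) // -sum_t -S0 S_le.
rewrite -(card_in_imset (f := h)); last first.
  move=> t u; rewrite !inE => /eqP st /eqP su eqh.
  have eqS j : S t j = S u j.
    have [lt_j|le_j] := ltnP j k.+1; last first.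
      by rewrite /S !big1 // => l; have := ltn_ord l => lt_l le_jl; lia.
    have := congr1 (fun E : chain_array k r.+1 B => nat_of_ord (E (Ordinal lt_j, ord0))) eqh.
    by rewrite !hE.
  apply: eq_from_tnth => j; apply: val_inj => /=.
  by apply: (@addIn (S t j.+1)); rewrite -S_rec [in RHS]eqS -S_rec eqS.
apply: subset_leq_card; apply/fintype.subsetP => E /imsetP[t]; rewrite !inE => /eqP st ->.
apply/andP; split.
  apply/is_chainP => j j' i i' le_j le_i; rewrite !hE //.
  case: (i' =P ord0) => // i'0; have -> : i = ord0.
    by apply: val_inj => /=; move: le_i; rewrite i'0 /=; lia.
  by rewrite eqxx S_le.
apply/eqP; rewrite /chain_size (bigD1 ord0) //= hE // eqxx big1 ?addn0 ?S0 //.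
by move=> i /negbTE i0; rewrite hE // i0.
Qed.

Variable R : realType.

(** Size at most [e], not exactly [e], so that all rows of a chain of size [e] are included. *)
Definition partition_count (r B e : nat) : nat :=
  #|[set l : {ffun 'I_r -> 'I_B.+1} |
     [forall i : 'I_r, forall j : 'I_r, (i <= j)%N ==> (l j <= l i)%N] &
     (\sum_i l i <= e)%N]|.

Lemma sum_geometric_le_inv (x : R) (n : nat) : 0 <= x -> x < 1 ->
  \sum_(i < n) x ^+ i <= (1 - x)^-1.
Proof.
move=> x0 x1; rewrite -[leRHS]mul1r ler_pdivlMr ?subr_gt0 //.
by have := subrX1 x n; have := exprn_ge0 n x0; lra.
Qed.

(* A partition is encoded by its consecutive differences [d], and has size
   [\sum_i i.+1 * d i]; this gives Euler's product [\prod_i (1 - x ^ i)^-1]. *)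
Lemma partition_count_le (x : R) (r B e : nat) : 0 < x -> x < 1 ->
  (partition_count r B e)%:R * x ^+ e <= expR ((1 - x)^-1 ^+ 2).
Proof.
move=> x0 x1; have y0 : 0 < 1 - x by rewrite subr_gt0.
pose L (l : {ffun 'I_r -> 'I_B.+1}) (i : nat) := if insub i is Some j then l j : nat else 0%N.
have LE l (i : 'I_r) : L l i = l i by rewrite /L valK.
have L0 l i : (r <= i)%N -> L l i = 0%N by move=> le_ri; rewrite /L insubF // ltnNge le_ri.
pose d (l : {ffun 'I_r -> 'I_B.+1}) : {ffun 'I_r -> 'I_B.+1} :=
  [ffun i : 'I_r => inord (L l i - L l i.+1)].
pose P := [set l : {ffun 'I_r -> 'I_B.+1} |
     [forall i : 'I_r, forall j : 'I_r, (i <= j)%N ==> (l j <= l i)%N] &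
     (\sum_i l i <= e)%N].
have dE l (i : 'I_r) : d l i = (L l i - L l i.+1)%N :> nat.
  by rewrite ffunE inordK // ltnS (leq_trans (leq_subr _ _)) // LE -ltnS.
have L_dec l i : l \in P -> (L l i.+1 <= L l i)%N.
  rewrite inE => /andP[/forallP h _].
  have [lt_i|le_i] := ltnP i.+1 r; last by rewrite L0.
  have := h (Ordinal (ltnW lt_i)) => /forallP/(_ (Ordinal lt_i))/implyP/(_ (leqnSn i)).
  by rewrite -!LE.
have d_inj : {in P &, injective d}.
  move=> l m lP mP eqd; suff eqL n i : (i + n = r)%N -> L l i = L m i.
    apply/ffunP => i; apply: val_inj => /=; rewrite -!LE.
    by apply: (eqL (r - i)%N); rewrite subnKC // ltnW.
  elim: n i => [|n IHn] i; first by rewrite addn0 => ->; rewrite !L0.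
  move=> i_n; have lt_i : (i < r)%N by lia.
  have := congr1 (fun f : {ffun 'I_r -> 'I_B.+1} => nat_of_ord (f (Ordinal lt_i))) eqd.
  rewrite !dE /=; have := L_dec l i lP; have := L_dec m i mP.
  have := IHn i.+1; rewrite addSnnS => /(_ i_n); lia.
have sum_d l : l \in P -> (\sum_(i < r) i.+1 * d l i = \sum_(i < r) l i)%N.
  move=> lP; under eq_bigr do rewrite dE.
  under [RHS]eq_bigr do rewrite -LE.
  (* Summation by parts, with the boundary term kept so that the induction goes through. *)
  have h n : (\sum_(i < n) i.+1 * (L l i - L l i.+1) + n * L l n = \sum_(i < n) L l i)%N.
    elim: n => [|n IHn]; first by rewrite !big_ord0.
    rewrite !big_ord_recr /= -IHn; have := L_dec l n lP => le_L.
    rewrite -addnA -mulnDr subnK // mulSn.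
    by rewrite [(L l n + _)%N]addnC addnA.
  by rewrite -(h r) L0 // muln0 addn0.
pose F (c : {ffun 'I_r -> 'I_B.+1}) : R := \prod_(i < r) (x ^+ i.+1) ^+ c i.
have F_ge0 c : 0 <= F c by apply: prodr_ge0 => i _; rewrite !exprn_ge0 // ltW.
(* Rankin's trick: since [x < 1], a partition of size at most [e] has weight at least [x ^ e]. *)
apply: (@le_trans _ _ (\sum_(l in P) F (d l))).
  rewrite /partition_count -/P mulr_natl -sumr_const; apply: ler_sum => l lP.
  rewrite /F; under eq_bigr do rewrite -exprM.
  rewrite -expr_sum sum_d //; move: lP; rewrite inE => /andP[_ le_e].
  by rewrite ler_wiXn2l // ltW.
rewrite -(big_imset F d_inj) /=.
apply: (@le_trans _ _ (\sum_c F c)).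
  by rewrite [leRHS](bigID (mem (finset.imset d (mem P)))) /= lerDl sumr_ge0.
rewrite -(bigA_distr_bigA (fun (i : 'I_r) (j : 'I_B.+1) => (x ^+ i.+1) ^+ j)) /=.
(* For [t = x ^ i.+1], the geometric series is at most [1 + t / (1 - t)], hence at most
   [1 + x ^ i / (1 - x)]. Summing the exponents over [i] contributes the second factor
   [1 / (1 - x)]. *)
apply: (@le_trans _ _ (\prod_(i < r) expR (x ^+ i * (1 - x)^-1))).
  apply: ler_prod => i _; rewrite sumr_ge0 /= => [|j _]; last by rewrite !exprn_ge0 // ltW.
  set t := x ^+ i.+1.
  have t0 : 0 <= t by rewrite exprn_ge0 // ltW.
  have t_x : t <= x by rewrite /t exprS ler_piMr ?(ltW x0) // exprn_ile1 // ltW.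
  have t_xi : t <= x ^+ i by rewrite /t exprS ler_piMl ?(ltW x1) // exprn_ge0 // ltW.
  have t1 : t < 1 by apply: le_lt_trans x1.
  apply: le_trans (sum_geometric_le_inv _ t0 t1) _.
  apply: le_trans (expR_ge1Dx _).
  have -> : (1 - t)^-1 = 1 + t * (1 - t)^-1 by field; rewrite subr_eq0 gt_eqF.
  rewrite lerD2l ler_pM ?invr_ge0 ?subr_ge0 ?(ltW t1) //.
  by rewrite lef_pV2 ?posrE ?subr_gt0 // lerD2l lerN2.
rewrite -expR_sum ler_expR -mulr_suml expr2 ler_wpM2r ?invr_ge0 ?(ltW y0) //.
exact: sum_geometric_le_inv (ltW x0) x1.
Qed.

(** Forgetting the inclusions between the rows leaves [k.+1] independent partitions. *)
Lemma chain_count_le_partition (r B e : nat) :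
  (chain_count k r B e <= partition_count r B e ^ k.+1)%N.
Proof.
pose P := [set l : {ffun 'I_r -> 'I_B.+1} |
     [forall i : 'I_r, forall j : 'I_r, (i <= j)%N ==> (l j <= l i)%N] &
     (\sum_i l i <= e)%N].
pose h (E : chain_array k r B) : {ffun 'I_k.+1 -> {ffun 'I_r -> 'I_B.+1}} :=
  [ffun j => [ffun i => E (j, i)]].
have h_inj : injective h.
  move=> E F /ffunP eqh; apply/ffunP => -[j i].
  by have /ffunP/(_ i) := eqh j; rewrite !ffunE.
rewrite -[X in (_ <= _ ^ X)%N]card_ord -(card_ffun_on 'I_k.+1 (mem P)).
rewrite /chain_count -(card_imset _ h_inj); apply: subset_leq_card.
apply/fintype.subsetP => f /imsetP[E]; rewrite inE => /andP[/is_chainP ch /eqP sz] ->.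
apply/ffun_onP => j; rewrite inE; apply/andP; split.
  apply/forallP => i; apply/forallP => i'; apply/implyP => le_i.
  by rewrite !ffunE ch.
by rewrite -sz; apply: leq_sum => i _; rewrite !ffunE ch.
Qed.

Lemma bernoulli (y : R) (n : nat) : 0 <= y -> y <= 1 -> 1 - n%:R * y <= (1 - y) ^+ n.
Proof.
move=> y0 y1; elim: n => [|n IHn]; first by rewrite mul0r subr0 expr0.
rewrite exprS; apply: (@le_trans _ _ ((1 - y) * (1 - n%:R * y))); last first.
  by rewrite ler_wpM2l ?subr_ge0.
rewrite -natr1 -subr_ge0.
have -> : (1 - y) * (1 - n%:R * y) - (1 - (n%:R + 1) * y) = n%:R * y ^+ 2 by ring.
by rewrite mulr_ge0 ?sqr_ge0.
Qed.

(* [x] is chosen so close to 1 that [x ^ (k + 1) >= 2 / 3]. *)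
Lemma chain_count_exp_le : exists C : R, forall r B e,
  (chain_count k r B e)%:R <= C * (3 / 2) ^+ e.
Proof.
pose y : R := (3 * k.+1%:R)^-1; pose x := 1 - y.
have k0 : 0 < k.+1%:R :> R by rewrite ltr0n.
have y0 : 0 < y by rewrite invr_gt0 mulr_gt0.
have k1 : 1 <= k.+1%:R :> R by rewrite ler1n.
have y1 : y < 1 by rewrite invf_lt1 ?mulr_gt0 //; lra.
have x0 : 0 < x by rewrite subr_gt0.
have x1 : x < 1 by rewrite /x; lra.
have xk : 2 / 3 <= x ^+ k.+1.
  apply: le_trans (bernoulli _ (ltW y0) (ltW y1)).
  have -> : k.+1%:R * y = 3^-1 by rewrite /y invfM mulrCA divff ?mulr1 // gt_eqF.
  lra.
exists (expR ((1 - x)^-1 ^+ 2) ^+ k.+1) => r B e.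
apply: (@le_trans _ _ ((partition_count r B e)%:R ^+ k.+1)).
  by rewrite -natrX ler_nat chain_count_le_partition.
have xe0 : 0 < x ^+ e by rewrite exprn_gt0.
have h : (partition_count r B e)%:R <= expR ((1 - x)^-1 ^+ 2) / x ^+ e.
  by rewrite ler_pdivlMr // partition_count_le.
apply: (@le_trans _ _ ((expR ((1 - x)^-1 ^+ 2) / x ^+ e) ^+ k.+1)).
  by rewrite lerXn2r ?nnegrE // divr_ge0 ?expR_ge0 // ltW.
rewrite exprMn ler_wpM2l ?exprn_ge0 ?expR_ge0 //.
rewrite -exprVn -exprM mulnC exprM lerXn2r ?nnegrE ?divr_ge0 ?exprn_ge0 ?invr_ge0 ?(ltW x0) //.
rewrite exprVn -[leRHS]invrK lef_pV2 ?posrE ?exprn_gt0 ?invr_gt0 //.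
by rewrite invf_div.
Qed.

End ChainCountBounds.

(** * Asymptotics of the class numbers *)

Lemma chain_count_eq (k r1 r2 B1 B2 e : nat) : (e <= B1)%N -> (e <= B2)%N ->
  (r1 == r2) || ((e <= r1) && (e <= r2))%N ->
  chain_count k r1 B1 e = chain_count k r2 B2 e.
Proof.
move=> le1 le2 r12; apply/eqP; rewrite eqn_leq !chain_count_le //.
  by case/orP: r12 => [/eqP->|/andP[-> _]]; rewrite ?leqnn ?orbT.
by case/orP: r12 => [/eqP->|/andP[_ ->]]; rewrite ?leqnn ?orbT.
Qed.

Lemma logn_le (N p n : nat) : (n <= N)%N -> (logn p n <= N)%N.
Proof.
have [->|n_gt0] := posnP n; first by rewrite logn0.
by move=> le_nN; rewrite (leq_trans _ le_nN) // ltnW // ltn_logl.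
Qed.

(* [rho e] caps the number of parts of the partitions in a chain of size [e]. *)
Lemma chain_count_asymptotic (R : realType) (k : nat) (rho count : nat -> nat) :
  (forall e, (0 < e)%N -> (0 < rho e)%N) ->
  (forall N, count N = \sum_(1 <= n < N.+1) \prod_(p < N.+1)
     chain_count k (rho (logn p n)) (logn p n) (logn p n))%N ->
  exists c : R, asymptotic (fun N : nat => (count N)%:R)
                  (fun N : nat => c * N%:R * ln (N%:R : R) ^+ k).
Proof.
move=> rho_gt0 countE.
pose f e : R := (chain_count k (rho e) e e)%:R.
have f_ge e : ('C(k + e, k) <= chain_count k (rho e) e e)%N.
  have [->|e_gt0] := posnP e; first by rewrite chain_count0 addn0 binn.
  by rewrite -(prednK (rho_gt0 e e_gt0)) chain_count_ge.
have f0 : f 0%N = 1 by rewrite /f chain_count0.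
have f1 : f 1%N = k.+1%:R.
  congr _%:R; apply/eqP; rewrite eqn_leq; apply/andP; split.
    by rewrite -(prednK (rho_gt0 1%N isT)) chain_count1_le.
  by apply: leq_trans (f_ge 1%N); rewrite addn1 binSn.
have [C fC] := chain_count_exp_le k R.
have [|e|c c_gt0 hc] := cvg_summ_mulf f0 f1 (C := C).
- by move=> e; rewrite ger0_norm ?ler0n //; exact: fC.
- by rewrite iter_psum_delta ler_nat.
exists c; rewrite /asymptotic.
have h := cvgMr_tmp (b := c^-1) hc; rewrite divff ?gt_eqF // in h.
apply: cvg_trans (h _); apply: near_eq_cvg; near=> N.
rewrite /scale -[c * _ * _ in RHS]mulrA [c * _ in RHS]mulrC [in RHS]invfM mulrA; congr (_ / _ / _).
rewrite countE natr_sum; apply: eq_big_nat => n /andP[n_gt0 lt_n].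
by rewrite (mulfE f0 (lt_n : (n <= N)%N)) natr_prod.
Unshelve. all: by end_near. Qed.

Lemma class_number_eq (X : Type) (E : X -> X -> Prop) (P Q : X -> Prop) (n : nat) :
  (forall x, P x <-> Q x) -> class_number E P n -> class_number E Q n.
Proof.
move=> PQ [x [Px inj cov]]; exists x; split=> [i||y /PQ/cov //]; first exact/PQ.
exact: inj.
Qed.

Theorem theorem2 (R : realType) (k : nat) (hk : (1 <= k)%N) :
  (forall r : nat, (1 <= r)%N ->
    exists2 count : nat -> nat,
      forall N : nat,
        class_number (@tower_isog k) (@abelian_tower_rank_le k r N) (count N)
    & exists c : R,
        asymptotic (fun N : nat => (count N)%:R)
                   (fun N : nat => c * N%:R * ln (N%:R : R) ^+ (k - 1)))
  /\
  (exists2 count : nat -> nat,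
      forall N : nat,
        class_number (@tower_isog k) (@abelian_tower_le k N) (count N)
    & exists c : R,
        asymptotic (fun N : nat => (count N)%:R)
                   (fun N : nat => c * N%:R * ln (N%:R : R) ^+ (k - 1))).
Proof.
case: k hk => // k _; rewrite subn1 /=; split=> [r r_gt0|].
  exists (fun N => #|[set A : tower_code k r N | is_code A]|).
    exact: class_number_rank_le.
  apply: (@chain_count_asymptotic R k (fun=> r)) => // N.
  rewrite card_codes; apply: eq_big_nat => n /andP[_ lt_n].
  by apply: eq_bigr => p _; apply: chain_count_eq; rewrite ?eqxx // logn_le.
(* A group is generated by its elements, so order at most [N] implies rank at most [N]. *)
exists (fun N => #|[set A : tower_code k N N | is_code A]|).
  move=> N; apply: class_number_eq (class_number_rank_le k N N) => T.
  split=> [[]//|[cT leT]]; split=> //; apply: leq_trans leT.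
  by rewrite -{1}(genGid (tower_top T)) grank_min.
(* Although the rank bound is [N], a chain of size [e] has at most [e] nonzero columns, so the local
   count does not depend on [N]. *)
apply: (@chain_count_asymptotic R k id) => // N.
rewrite card_codes; apply: eq_big_nat => n /andP[_ lt_n].
by apply: eq_bigr => p _; apply: chain_count_eq; rewrite ?leqnn ?andbT ?logn_le ?orbT.
Qed.
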